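(* Let $\mathcal{H}$ be a complex Hilbert space, let $T\in\mathcal{B}(\mathcal{H})$ be nonzero with polar decomposition $T=U|T|$, let $0\le t\le 1$, and let $\widetilde{T}_t=|T|^tU|T|^{1-t}$ be the generalized Aluthge transform of $T$. Put $$S_t=\|T\|^{2t-1}|T|^{2(1-t)}+\|T\|^{1-2t}|T|^{2t}.$$ Then $$\omega(T)\le\frac12\sqrt{\|T\|^2+\omega\big(\widetilde{T}_t\big)^2+\frac12\,\omega\big(S_t\widetilde{T}_t+\widetilde{T}_tS_t\big)}.$$
   Context: $\mathcal{B}(\mathcal{H})$ is the $C^*$-algebra of all bounded linear operators on $\mathcal{H}$. For $X\in\mathcal{B}(\mathcal{H})$, $\|X\|$ is the operator norm, $\omega(X)=\sup_{\|x\|=1}|\langle Xx,x\rangle|$ is the numerical radius, and $|X|=(X^*X)^{1/2}$. In the polar decomposition $T=U|T|$, $U$ is the partial isometry with $\ker U=\ker T$. Powers of the positive operator $|T|$ are taken by the continuous functional calculus, with the convention $|T|^0=I$. *)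

(* Defs.v *)
From HB Require Import structures.
From mathcomp Require Export all_boot all_order all_algebra.
From mathcomp Require Export complex.
From mathcomp Require Export all_classical all_reals all_analysis.

Set Implicit Arguments.
Unset Strict Implicit.
Unset Printing Implicit Defensive.

Import Order.TTheory GRing.Theory Num.Theory.
Import numFieldTopology.Exports numFieldNormedType.Exports.

Local Open Scope classical_set_scope.
Local Open Scope ring_scope.
Local Open Scope complex_scope.

Section BoundedOperators.
Variables (R : realType) (H : completeNormedModType R[i]).
Implicit Types (A B : H -> H) (p : {poly R[i]}) (f : R[i] -> R[i]).

(* [A] belongs to B(H). *)
Definition bounded_operator A : Prop :=
  linear A /\ exists M : R[i], forall x : H, `|A x| <= M * `|x|.

(* Norms on [H] and moduli take values in [R[i]] (with zero imaginary part);
   [complex.Re] brings them back to [R], where suprema exist. *)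
Definition opnorm A : R :=
  sup [set complex.Re `|A x| | x in [set x : H | `|x| <= 1]].

(* The spectrum relative to the algebra B(H): the inverse has to be bounded. *)
Definition spectrum A : set R[i] :=
  [set z | ~ exists2 B, bounded_operator B &
     forall x : H, A (B x) - z *: B x = x /\ B (A x - z *: x) = x].

Definition oppoly p A : H -> H :=
  fun x => \sum_(i < size p) p`_i *: iter i A x.

(* The continuous functional calculus f(A) of a bounded self-adjoint operator:
   the limit in operator norm of the p_n(A), for polynomials p_n that converge
   to f uniformly on the spectrum of A. For such an A and for f continuous on
   the spectrum, polynomials p_n exist by Weierstrass' theorem, and the limit
   exists and does not depend on their choice. *)
Definition cfc f A : H -> H :=
  get [set B | bounded_operator B /\
    exists2 p : nat -> {poly R[i]},
      (forall e : R, 0 < e -> \forall n \near \oo, forall z,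
         spectrum A z -> `|(p n).[z] - f z| <= e%:C) &
      opnorm (fun x => oppoly (p n) A x - B x) @[n --> \oo] --> (0 : R)].

(* A^s for A positive (its spectrum is then real and nonnegative) and s >= 0.
   As 0 `^ 0 = 1, the function is constant for s = 0, so A^0 = I. *)
Definition oppow A (s : R) : H -> H :=
  cfc (fun z => (complex.Re z `^ s)%:C) A.

(* In what follows [dot] is the inner product, linear in its first argument and
   conjugate-linear in the second. *)
Variable dot : {dot H for Num.conj}.

Definition adjoint A : H -> H :=
  get [set B | bounded_operator B /\ forall x y, dot (A x) y = dot x (B y)].

Definition absop A : H -> H := oppow (adjoint A \o A) 2^-1.

Definition numrad A : R :=
  sup [set complex.Re `|dot (A x) x| | x in [set x : H | `|x| = 1]].

Definition kernel A : set H := [set x | A x = 0].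

Definition orthocompl (K : set H) : set H :=
  [set x | forall y, K y -> dot x y = 0].

Definition partial_isometry A : Prop :=
  bounded_operator A /\
  forall x, orthocompl (kernel A) x -> `|A x| = `|x|.

Definition polar_decomposition T U : Prop :=
  [/\ partial_isometry U, kernel U = kernel T & T = U \o absop T].

Definition aluthge T U (t : R) : H -> H :=
  oppow (absop T) t \o U \o oppow (absop T) (1 - t).

Definition aluthge_weight T (t : R) : H -> H := fun x =>
  (opnorm T `^ (2 * t - 1))%:C *: oppow (absop T) (2 * (1 - t)) x
  + (opnorm T `^ (1 - 2 * t))%:C *: oppow (absop T) (2 * t) x.

End BoundedOperators.

(* Main.v *)
Require Import Defs.
From mathcomp Require Import ring lra.

(** Write [P = |T|], [c = ||T||^((1 - 2t)/2)], and put [X = c P^t] and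
    [Y = c^-1 P^(1-t)]. These are self-adjoint, and the powers are weighted so
    that everything in sight is a product of [X], [Y] and [U]: [T = U Y X], the
    Aluthge transform is [Tt = X U Y], and [S_t = Y^2 + X^2], whose norm is at
    most [2 ||T||] since [||P^s|| <= ||T||^s].

    For a unit vector [x], let [u] be the unit complex number that makes
    [u <T x, x>] equal to [|<T x, x>|]. With [A = u X + Y U^*], the identity
    [u <T x, x> = <u X x, Y U^* x>] and polarization give
    [|<T x, x>| <= ||A x||^2 / 4 <= ||A^*||^2 / 4]. As [U] is a contraction,
    [A A^* <= W := S_t + 2 Re (u Tt)], and [W] is self-adjoint, so
    [||A^*||^2 <= ||W||]. Finally, expanding the square,
    [||W y||^2 = ||S_t y||^2 + ||2 Re (u Tt) y||^2
                 + 2 Re (u <(S_t Tt + Tt S_t) y, y>)],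
    where the norm of the self-adjoint operator [2 Re (u Tt)] is at most
    [2 w(Tt)]. This is the inequality, in the form
    [w(T) <= ||W|| / 4] with
    [||W||^2 <= 4 ||T||^2 + 4 w(Tt)^2 + 2 w(S_t Tt + Tt S_t)];
    see [numrad_factorization].

    The rest is the operator theory behind the words used above. Adjoints come
    from Riesz representation, hence from the projection theorem. For the powers
    of [P], the point is that [||p(A)||] is at most the supremum of [|p|] on the
    spectrum of a self-adjoint [A] ([oppoly_norm_le]). This is obtained without
    the spectral radius formula: with [m = ||p(A)||], the operator
    [p(A)^* p(A) - m^2] is not invertible, because [p(A)] nearly attains its norm;
    it is a polynomial in [A], so one of its roots [z] lies in the spectrum, where
    [z] is real and the equation reads [|p(z)| = m]. Consequently a limit of
    polynomials in [A] depends only on the limit function on the spectrum, and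
    calculus with these limits is multiplicative; Weierstrass approximation on
    an interval containing the spectrum makes them exist for [x^s]. *)

Set Implicit Arguments.
Unset Strict Implicit.
Unset Printing Implicit Defensive.

Import Order.TTheory GRing.Theory Num.Theory.
Import numFieldTopology.Exports numFieldNormedType.Exports.

Local Open Scope classical_set_scope.
Local Open Scope ring_scope.
Local Open Scope complex_scope.

Import ComplexField.Normc.

Local Notation Re := complex.Re.
Local Notation Im := complex.Im.

(** * Weierstrass approximation *)

Section Weierstrass.
Variable R : realType.
Implicit Types (f : R -> R) (g h : nat -> R) (x c M e : R).

(** The [n]th Bernstein polynomial of [k/n |-> g k], as the expectation of [g] at
    the number of successes in [n] trials: the recursion conditions on the first
    trial, so no binomial coefficient appears. *)
Fixpoint bernstein (n : nat) g : {poly R} :=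
  if n is m.+1 then
    (1 - 'X) * bernstein m g + 'X * bernstein m (g \o S)
  else (g 0%N)%:P.

Lemma bernsteinS n g x : (bernstein n.+1 g).[x] =
  (1 - x) * (bernstein n g).[x] + x * (bernstein n (g \o S)).[x].
Proof. by rewrite /= !hornerE. Qed.

Lemma bernstein_affine n g h a b x :
  (bernstein n (fun k => a * g k + b * h k)).[x] =
  a * (bernstein n g).[x] + b * (bernstein n h).[x].
Proof.
elim: n g h => [|n IH] g h; first by rewrite /= !hornerE.
by rewrite !bernsteinS IH (IH (g \o S) (h \o S)); ring.
Qed.

Lemma bernstein_cst n a x : (bernstein n (fun=> a)).[x] = a.
Proof.
elim: n => [|n IH]; first by rewrite /= hornerE.
by rewrite bernsteinS (_ : (fun=> a) \o S = fun=> a) // IH; ring.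
Qed.

Lemma bernstein_le n g h x : 0 <= x <= 1 -> (forall k, (k <= n)%N -> g k <= h k) ->
  (bernstein n g).[x] <= (bernstein n h).[x].
Proof.
move=> /andP[x0 x1]; elim: n g h => [|n IH] g h gh.
  by rewrite /= !hornerE gh.
rewrite !bernsteinS lerD// ler_wpM2l// ?subr_ge0// IH// => k kn.
- by rewrite gh// ltnW.
- by rewrite /= gh.
Qed.

(** The variance [n x (1 - x)] of a binomial law, plus the square of the distance
    from its mean to [c]; leaving [c] free makes the induction go through. *)
Lemma bernstein_sqr n c x :
  (bernstein n (fun k => (k%:R - c) ^+ 2)).[x] =
  n%:R * x * (1 - x) + (n%:R * x - c) ^+ 2.
Proof.
elim: n c => [|n IH] c; first by rewrite /= hornerE; ring.
rewrite bernsteinS IH.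
have -> : (fun k : nat => (k%:R - c) ^+ 2) \o S =
          (fun k : nat => (k%:R - (c - 1)) ^+ 2).
  by apply/funext => k /=; rewrite -natr1; ring.
by rewrite IH -natr1; ring.
Qed.

(** Uniform continuity in the form that an expectation can use: the term
    quadratic in [y - x] averages to a variance. Near the diagonal continuity
    gives [e]; away from it, [f] is bounded. *)
Lemma quadratic_modulus f M e : 0 < e -> continuous f ->
  exists2 C, 0 < C & forall x y, 0 <= x <= M -> 0 <= y <= M ->
    `|f y - f x| <= e + C * (y - x) ^+ 2.
Proof.
move=> e0 cf.
have cK : compact `[0, M]%classic by exact: segment_compact.
have [b fb] : exists b : R, forall x : R, 0 <= x <= M -> `|f x| <= b.
  have : bounded_set (f @` `[0, M]%classic).
    apply: compact_bounded; apply: continuous_compact => //.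
    exact: continuous_subspaceT.
  case=> b [_ /(_ (b + 1))]; rewrite ltrDl ltr01 => /(_ isT) fb.
  by exists (b + 1) => x x0M; apply: fb; exists x => //=; rewrite in_itv.
have : \forall C \near +oo, forall x, `[0, M]%classic x ->
    forall y, 0 <= x <= M -> 0 <= y <= M -> `|f y - f x| <= e + C * (y - x) ^+ 2.
  move/compact_near_coveringP : cK => cK.
  apply: (cK R (+oo%R : set_system R) _ _ _) => x _.
  have /cvgrPdist_lt/(_ (e / 2)) := cf x.
  rewrite divr_gt0// => /(_ isT); case=> d /= d0 fd.
  exists (ball x (d / 2), [set C | 2 * b / (d / 2) ^+ 2 < C /\ 0 < C]) => /=.
    split; first by exists (d / 2) => //=; rewrite divr_gt0.
    by apply: filterI; apply: nbhs_pinfty_gt; rewrite num_real.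
  move=> [z C] /= [xz [bC C0]] y zM yM.
  have [zy|zy] := ltP `|y - z| (d / 2).
    (* [x] is the centre of the compactness argument, [z] and [y] are near it *)
    have fxz : `|f x - f z| < e / 2.
      by apply: fd; rewrite /= (lt_le_trans xz)// ler_pdivrMr// ler_peMr ?ltW//; lra.
    have fxy : `|f x - f y| < e / 2.
      apply: fd; rewrite /= (_ : x - y = (x - z) - (y - z)); last by ring.
      by rewrite (le_lt_trans (ler_normB _ _))// (splitr d) ltrD.
    have -> : f y - f z = (f x - f z) - (f x - f y) by ring.
    rewrite (le_trans (ler_normB _ _))//.
    have : 0 <= C * (y - z) ^+ 2 by rewrite mulr_ge0 ?sqr_ge0 ?ltW.
    by lra.
  (* away from the diagonal, [C] is large enough to absorb [2 b] *)
  have fyz : `|f y - f z| <= 2 * b.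
    have := fb _ yM; have := fb _ zM.
    by move=> ? ?; rewrite (le_trans (ler_normB _ _))//; lra.
  apply: (le_trans fyz); apply: ler_wpDl; first exact: ltW.
  have d2 : 0 < (d / 2) ^+ 2 by rewrite exprn_gt0 ?divr_gt0.
  move: bC; rewrite ltr_pdivrMr// => /ltW/le_trans; apply.
  rewrite ler_wpM2l ?(ltW C0)// -[leRHS]real_normK ?num_real// lerXn2r// nnegrE.
  by rewrite divr_ge0// ltW.
move=> nearC; have [C [C0 HC]] : exists C, 0 < C /\ forall x, `[0, M]%classic x ->
    forall y, 0 <= x <= M -> 0 <= y <= M -> `|f y - f x| <= e + C * (y - x) ^+ 2.
  near (+oo%R : set_system R) => C; exists C; split; near: C => //.
  by apply: nbhs_pinfty_gt; rewrite num_real.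
by exists C => // x y xM; apply: HC; rewrite //= in_itv.
Unshelve. all: by end_near. Qed.

(** The Bernstein polynomials [B_n] of the rescaled function converge: as they
    are averages, the quadratic modulus bounds [|B_n - f|] by [e / 2 + C M^2 v],
    where [v = u (1 - u) / n] is the variance of the mean of [n] trials of
    probability [u = x / M]. *)
Lemma weierstrass f M e : 0 < M -> 0 < e -> continuous f ->
  exists p : {poly R}, forall x, 0 <= x <= M -> `|p.[x] - f x| <= e.
Proof.
move=> M0 e0 cf.
have e20 : 0 < e / 2 by rewrite divr_gt0.
have [C C0 fC] := quadratic_modulus M e20 cf.
pose n := (Num.truncn (C * M ^+ 2 / (e / 2))).+1.
have n0 : 0 < n%:R :> R by rewrite ltr0n.
pose p := bernstein n (fun k => f (M * k%:R / n%:R)).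
exists (p \Po (M^-1 *: 'X)) => x xM.
pose u := M^-1 * x.
have -> : (p \Po (M^-1 *: 'X)).[x] = p.[u] by rewrite horner_comp hornerZ hornerX.
have u01 : 0 <= u <= 1.
  case/andP: xM => x0 xM; rewrite /u mulr_ge0 ?invr_ge0 ?(ltW M0)//=.
  by rewrite ler_pdivrMl// mulr1.
have xE : x = M * u by rewrite /u mulrA divff ?mul1r// gt_eqF.
pose w k : R := e / 2 + C * M ^+ 2 / n%:R ^+ 2 * (k%:R - n%:R * u) ^+ 2.
have fw k : (k <= n)%N -> `|f (M * k%:R / n%:R) - f x| <= w k.
  move=> kn; apply: le_trans (fC _ _ xM _) _.
    rewrite divr_ge0 ?mulr_ge0 ?(ltW M0) ?ler0n//=.
    by rewrite ler_pdivrMr// ler_pM2l// ler_nat.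
  rewrite /w lerD2l xE le_eqVlt; apply/orP; left; apply/eqP; field.
  by rewrite gt_eqF.
have wE : (bernstein n w).[u] <= e.
  have -> : w = fun k : nat => e / 2 * 1 + C * M ^+ 2 / n%:R ^+ 2 * (k%:R - n%:R * u) ^+ 2.
    by apply/funext => k; rewrite mulr1.
  rewrite (bernstein_affine _ (fun=> 1)) bernstein_cst bernstein_sqr mulr1.
  rewrite subrr expr0n addr0 {2}(splitr e) lerD2l.
  have Cn : C * M ^+ 2 / (e / 2) < n%:R.
    by rewrite /n real_truncnS_gt ?num_real.
  have uu : u * (1 - u) <= 1.
    by case/andP: u01 => u0 u1; rewrite -[1]mulr1 ler_pM//; lra.
  have -> : C * M ^+ 2 / n%:R ^+ 2 * (n%:R * u * (1 - u)) =
            C * M ^+ 2 / n%:R * (u * (1 - u)) by field; rewrite gt_eqF.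
  have CM : 0 <= C * M ^+ 2 / n%:R.
    by rewrite divr_ge0 ?ler0n// mulr_ge0 ?sqr_ge0// (ltW C0).
  rewrite (le_trans (ler_wpM2l CM uu))// mulr1 ler_pdivrMr//.
  by move: Cn; rewrite ltr_pdivrMr// [n%:R * _]mulrC => /ltW.
have bE (s : R) : (bernstein n (fun k => 1 * f x + s * w k)).[u] =
    f x + s * (bernstein n w).[u].
  by rewrite (bernstein_affine _ (fun=> f x)) bernstein_cst mul1r.
have ub : p.[u] <= f x + 1 * (bernstein n w).[u].
  rewrite -bE bernstein_le// => k kn; have := fw k kn.
  by rewrite ler_norml => /andP[_]; lra.
have lb : f x + (-1) * (bernstein n w).[u] <= p.[u].
  rewrite -bE bernstein_le// => k kn; have := fw k kn.
  by rewrite ler_norml => /andP[+ _]; rewrite mul1r mulN1r lerBrDl.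
by rewrite ler_norml; lra.
Qed.

(** The absolute value extends [x^s] from the half-line to a continuous function;
    for negative [x], the power [x `^ s] itself is constantly [1]. *)
Lemma continuous_powR_abs (s : R) : 0 <= s -> continuous (fun x : R => `|x| `^ s).
Proof.
rewrite le_eqVlt => /predU1P[<-|s0] x.
  rewrite (_ : (fun x => _) = fun=> 1); last by apply/funext => y; rewrite powRr0.
  exact: cvg_cst.
have [->|x0] := eqVneq x 0.
  apply/cvgrPdist_lt => e e0; rewrite normr0 powR0 ?gt_eqF//.
  exists (e `^ s^-1) => /=; first by rewrite powR_gt0.
  move=> y /=; rewrite !sub0r !normrN => ye.
  rewrite ger0_norm ?powR_ge0//.
  have -> : e = (e `^ s^-1) `^ s by rewrite -powRrM mulVf ?gt_eqF// powRr1// ltW.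
  by rewrite gt0_ltr_powR// nnegrE ?powR_ge0.
apply: (@continuous_comp _ _ _ (fun x : R => `|x|) (fun y => y `^ s)).
  exact: norm_continuous.
apply: differentiable_continuous; apply/derivable1_diffP.
by apply: derivable_powR; rewrite in_itv/= andbT normr_gt0.
Qed.

End Weierstrass.

(** * Norm and inner product *)

Section Archimedean.
Variable R : realType.

Lemma invS_gt0 (n : nat) : 0 < n.+1%:R^-1 :> R.
Proof. by rewrite invr_gt0 ltr0n. Qed.

Lemma invS_le (e : R) : 0 < e -> exists N, forall n, (N <= n)%N -> n.+1%:R^-1 <= e.
Proof.
move=> e0; exists (Num.truncn e^-1) => n Nn.
rewrite -[leRHS]invrK lef_pV2 ?posrE ?ltr0n ?invr_gt0//.
by rewrite (le_trans (ltW (real_truncnS_gt (num_real _))))// ler_nat.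
Qed.

End Archimedean.

Section Norm.
Variables (R : realType) (H : completeNormedModType R[i]).
Implicit Types (x y z : H) (a : R[i]) (A B C : H -> H).

Definition nrm x : R := Re `|x|.

Lemma nrmE x : `|x| = (nrm x)%:C.
Proof. by rewrite RRe_real// normr_real. Qed.

Lemma norm_normc a : `|a| = (normc a)%:C.
Proof. by []. Qed.

Lemma nrm_ge0 x : 0 <= nrm x.
Proof. by rewrite -ler0c -nrmE. Qed.

Lemma nrm_le x (r : R) : (`|x| <= r%:C) = (nrm x <= r).
Proof. by rewrite nrmE lecR. Qed.

Lemma nrm_lt x (r : R) : (`|x| < r%:C) = (nrm x < r).
Proof. by rewrite nrmE ltcR. Qed.

Lemma nrmD x y : nrm (x + y) <= nrm x + nrm y.
Proof. by rewrite -nrm_le rmorphD/= -!nrmE ler_normD. Qed.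

Lemma nrmN x : nrm (- x) = nrm x.
Proof. by rewrite /nrm normrN. Qed.

Lemma nrmB x y : nrm (x - y) <= nrm x + nrm y.
Proof. by rewrite -(nrmN y) nrmD. Qed.

Lemma nrmZ a x : nrm (a *: x) = normc a * nrm x.
Proof. by apply: complexI; rewrite -nrmE normrZ nrmE norm_normc rmorphM. Qed.

Lemma nrm0 : nrm 0 = 0.
Proof. by rewrite /nrm normr0. Qed.

Lemma nrm_eq0 x : (nrm x == 0) = (x == 0).
Proof. by rewrite -(inj_eq (@complexI R)) -nrmE normr_eq0. Qed.

Lemma nrm_gt0 x : (0 < nrm x) = (x != 0).
Proof. by rewrite lt_def nrm_eq0 nrm_ge0 andbT. Qed.

Lemma nrm_distC x y : nrm (x - y) = nrm (y - x).
Proof. by rewrite -nrmN opprB. Qed.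

Lemma normc_ge0 a : 0 <= normc a.
Proof. by rewrite -ler0c -norm_normc. Qed.

Lemma normc_real (r : R) : normc r%:C = `|r|.
Proof. by rewrite /= expr0n addr0 sqrtr_sqr. Qed.

Definition nrm_cvg (u : nat -> H) l :=
  forall e : R, 0 < e -> exists N, forall n, (N <= n)%N -> nrm (u n - l) <= e.

Lemma nrm_complete (u : nat -> H) :
  (forall e : R, 0 < e -> exists N, forall m n, (N <= m)%N -> (N <= n)%N ->
     nrm (u m - u n) <= e) ->
  exists l, nrm_cvg u l.
Proof.
move=> cu.
have real_gt0 (e : R[i]) : 0 < e -> e = (Re e)%:C /\ 0 < Re e.
  move=> e0; have eE : e = (Re e)%:C by rewrite RRe_real// gtr0_real.
  by split=> //; rewrite -ltcR -eE.
have : cvgn u.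
  apply: cauchy_cvg; apply/cauchyP => e /real_gt0[eE e0].
  have [|N HN] := cu (Re e / 2); first by rewrite divr_gt0.
  exists (u N); exists N => // n /= Nn; rewrite -ball_normE /= eE nrm_lt.
  by rewrite (le_lt_trans (HN N n _ _))// ltr_pdivrMr// ltr_pMr// ltr1n.
move=> /cvg_ex[l /= ul]; exists l => e e0.
move/cvgrPdist_le : ul => /(_ e%:C); rewrite ltcR => /(_ e0)[N _ HN].
by exists N => n /HN /=; rewrite nrm_le nrm_distC.
Qed.

End Norm.

Section InnerProduct.
Variables (R : realType) (H : completeNormedModType R[i]).
Variable dot : {dot H for Num.conj}.
Hypothesis dotE : forall x : H, dot x x = `|x| ^+ 2.
Implicit Types (x y z : H) (a : R[i]) (A B C : H -> H).

Lemma dotDl x y z : dot (x + y) z = dot x z + dot y z.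
Proof. exact: linearDl. Qed.
Lemma dotDr x y z : dot z (x + y) = dot z x + dot z y.
Proof. exact: linearDr. Qed.
Lemma dotZl a x y : dot (a *: x) y = a * dot x y :> R[i].
Proof. exact: linearZl_LR. Qed.
Lemma dotZr a x y : dot x (a *: y) = conjc a * dot x y :> R[i].
Proof. by rewrite linearZr_LR. Qed.
Lemma dotC x y : dot x y = conjc (dot y x) :> R[i].
Proof. by rewrite hermC expr0 mul1r. Qed.
Lemma dotNl x y : dot (- x) y = - dot x y.
Proof. by rewrite -scaleN1r dotZl mulN1r. Qed.
Lemma dotNr x y : dot x (- y) = - dot x y.
Proof. by rewrite -scaleN1r dotZr rmorphN1 mulN1r. Qed.
Lemma dotBl x y z : dot (x - y) z = dot x z - dot y z.
Proof. by rewrite dotDl dotNl. Qed.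
Lemma dotBr x y z : dot z (x - y) = dot z x - dot z y.
Proof. by rewrite dotDr dotNr. Qed.

Lemma dot0l x : dot 0 x = 0.
Proof. by rewrite -(subrr (0 : H)) dotBl subrr. Qed.
Lemma dot0r x : dot x 0 = 0.
Proof. by rewrite -(subrr (0 : H)) dotBr subrr. Qed.

(** The inner product of [H] as a real vector space. *)
Definition rip x y : R := Re (dot x y).

Lemma ripC x y : rip x y = rip y x.
Proof. by rewrite /rip dotC; case: (dot y x). Qed.
Lemma ripDl x y z : rip (x + y) z = rip x z + rip y z.
Proof. by rewrite /rip dotDl raddfD. Qed.
Lemma ripDr x y z : rip z (x + y) = rip z x + rip z y.
Proof. by rewrite /rip dotDr raddfD. Qed.
Lemma ripNl x y : rip (- x) y = - rip x y.
Proof. by rewrite /rip dotNl raddfN. Qed.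
Lemma ripNr x y : rip x (- y) = - rip x y.
Proof. by rewrite /rip dotNr raddfN. Qed.
Lemma ripZl (r : R) x y : rip (r%:C *: x) y = r * rip x y.
Proof. by rewrite /rip dotZl; case: (dot x y) => ? ?; simpc. Qed.
Lemma ripZr (r : R) x y : rip x (r%:C *: y) = r * rip x y.
Proof. by rewrite ripC ripZl ripC. Qed.

Lemma dot_nrm x : dot x x = (nrm x ^+ 2)%:C.
Proof. by rewrite dotE nrmE rmorphXn. Qed.

Lemma rip_nrm x : rip x x = nrm x ^+ 2.
Proof. by rewrite /rip dot_nrm. Qed.

Lemma nrmD_sqr x y : nrm (x + y) ^+ 2 = nrm x ^+ 2 + nrm y ^+ 2 + 2 * rip x y.
Proof. by rewrite -!rip_nrm ripDl !ripDr (ripC y x); ring. Qed.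

Lemma nrmB_sqr x y : nrm (x - y) ^+ 2 = nrm x ^+ 2 + nrm y ^+ 2 - 2 * rip x y.
Proof. by rewrite nrmD_sqr ripNr nrmN; ring. Qed.

Lemma parallelogram x y :
  nrm (x + y) ^+ 2 + nrm (x - y) ^+ 2 = 2 * nrm x ^+ 2 + 2 * nrm y ^+ 2.
Proof. by rewrite nrmD_sqr nrmB_sqr; ring. Qed.

(** From [0 <= || |y| x - |x| y ||^2]. *)
Lemma rip_le x y : rip x y <= nrm x * nrm y.
Proof.
have [->|x0] := eqVneq x 0.
  by rewrite nrm0 mul0r /rip dot0l.
have [->|y0] := eqVneq y 0.
  by rewrite nrm0 mulr0 /rip dot0r.
have : 0 <= nrm ((nrm y)%:C *: x - (nrm x)%:C *: y) ^+ 2 by rewrite sqr_ge0.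
rewrite nrmB_sqr !nrmZ !normc_real ripZl ripZr !ger0_norm ?nrm_ge0//.
have -> : (nrm y * nrm x) ^+ 2 + (nrm x * nrm y) ^+ 2 -
  2 * (nrm y * (nrm x * rip x y)) =
  2 * (nrm x * nrm y) * (nrm x * nrm y - rip x y) by ring.
by rewrite pmulr_rge0 ?subr_ge0// !mulr_gt0// nrm_gt0.
Qed.

Lemma normc_sqr a : normc a ^+ 2 = Re a ^+ 2 + Im a ^+ 2.
Proof. by case: a => b c /=; rewrite sqr_sqrtr// addr_ge0 ?sqr_ge0. Qed.

Lemma Re_conj_mul (s : R) a : Re (conjc (s%:C * a) * a) = s * normc a ^+ 2.
Proof. by rewrite normc_sqr; case: a => b c /=; ring. Qed.

(** Rotations reduce a bound on [|dot x y|] to a bound on a real part. *)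
Lemma rotation a : exists2 u, normc u = 1 & u * a = (normc a)%:C.
Proof.
have [->|a0] := eqVneq a 0; first by exists 1; rewrite ?normc1// mulr0 normc0.
have na0 : normc a != 0 by apply: contra a0 => /eqP/eq0_normc ->.
exists ((normc a)%:C / a).
  by rewrite normcM normcV normc_real ger0_norm ?normc_ge0// divff.
by rewrite divfK.
Qed.

Lemma cauchy_schwarz x y : normc (dot x y) <= nrm x * nrm y.
Proof.
have [u u1 uE] := rotation (dot x y).
have -> : normc (dot x y) = rip (u *: x) y by rewrite /rip dotZl uE.
by rewrite (le_trans (rip_le _ _))// nrmZ u1 mul1r.
Qed.

Lemma Re_le_normc a : Re a <= normc a.
Proof.
by rewrite (le_trans (ler_norm _))// -lecR -norm_normc normc_ge_Re.
Qed.

Lemma dot_ext x y : (forall z, dot x z = dot y z) -> x = y.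
Proof.
move=> xy; apply/eqP; rewrite -subr_eq0 -nrm_eq0 -sqrf_eq0 -rip_nrm /rip.
by rewrite dotBl xy subrr.
Qed.

Lemma dot_extr x y : (forall z, dot z x = dot z y) -> x = y.
Proof. by move=> xy; apply: dot_ext => z; rewrite dotC xy -dotC. Qed.

(** Projection theorem. A minimizing sequence in [K] for the distance to [x]
    is Cauchy by the parallelogram law; its limit [k] is the point of [K]
    nearest to [x], and moving [k] along a vector of [K] cannot improve it. *)
Lemma projection (K : set H) x :
  K 0 -> (forall a y z, K y -> K z -> K (a *: y + z)) ->
  (forall u l, (forall n, K (u n)) -> nrm_cvg u l -> K l) ->
  exists2 k, K k & forall y, K y -> dot (x - k) y = 0.
Proof.
move=> K0 KD Kcl.
pose E := [set nrm (x - k) ^+ 2 | k in K].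
have E0 : E !=set0 by exists (nrm (x - 0) ^+ 2), 0.
have Elb : has_lbound E by exists 0 => _ [k _ <-]; rewrite sqr_ge0.
have [d [d0 dK dE]] : exists d, [/\ 0 <= d, forall k, K k -> d <= nrm (x - k) ^+ 2 &
    forall e, 0 < e -> exists k, K k /\ nrm (x - k) ^+ 2 < d + e].
  exists (inf E); split=> [|k Kk|e e0].
  - by apply: lb_le_inf => // _ [k' _ <-]; rewrite sqr_ge0.
  - by apply: ge_inf => //; exists k.
  - by have [|_ [k Kk <-] lt] := @inf_lt _ E (inf E + e) E0; [rewrite ltrDl|exists k].
have /choice[u uP] (n : nat) : exists k, K k /\ nrm (x - k) ^+ 2 < d + n.+1%:R^-1.
  by apply: dE; exact: invS_gt0.
have uK n : K (u n) by case: (uP n).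
(* the parallelogram law at [x - y] and [x - z], whose half sum is at distance
   at least [sqrt d] from [0] *)
have half y z : K y -> K z -> nrm (y - z) ^+ 2 <=
    2 * nrm (x - y) ^+ 2 + 2 * nrm (x - z) ^+ 2 - 4 * d.
  move=> Ky Kz.
  have := parallelogram (x - y) (x - z).
  have -> : (x - y) + (x - z) = 2%:C *: (x - 2^-1%:C *: (y + z)).
    rewrite scalerBr scalerA -rmorphM/= divff ?pnatr_eq0// scale1r.
    by rewrite [2]mulr2n rmorphD/= scalerDl scale1r opprD addrACA.
  have -> : (x - y) - (x - z) = - (y - z) by rewrite !opprB addrC addrA subrK.
  rewrite nrmN nrmZ normc_real ger0_norm// => PE.
  have Kyz : K (2^-1%:C *: (y + z)).
    by rewrite -[_ *: _]addr0; apply: (KD) => //; rewrite -[y]scale1r; apply: KD.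
  have := dK _ Kyz; move: PE; rewrite exprMn; lra.
have [k ku] : exists l, nrm_cvg u l.
  apply: nrm_complete => e e0.
  have [|N HN] := @invS_le R (e ^+ 2 / 4); first by rewrite divr_gt0// exprn_gt0.
  exists N => m n Nm Nn.
  rewrite -(@ler_pXn2r _ 2)// ?nnegrE ?nrm_ge0 ?(ltW e0)//.
  have := half _ _ (uK m) (uK n); have [_] := uP m; have [_] := uP n.
  have := HN _ Nm; have := HN _ Nn; move: (m.+1%:R^-1) (n.+1%:R^-1) => i j; lra.
have Kk : K k by exact: Kcl ku.
have kd : nrm (x - k) ^+ 2 <= d.
  apply/ler_addgt0Pr => e e0.
  have D0 : 0 < 2 * (d + 3) + e by lra.
  (* [(x - u n) + (u n - k)] has square norm at most [d + e / 2 + h (d + 3)] *)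
  pose h := e / (2 * (d + 3) + e).
  have h0 : 0 < h by rewrite divr_gt0.
  have h1 : h <= 1 by rewrite ler_pdivrMr// mul1r; lra.
  have hd : h * (d + 3) <= e / 2.
    have : h * (2 * (d + 3) + e) = e by rewrite divfK// gt_eqF.
    by have := mulr_gt0 h0 e0; lra.
  have [N1 HN1] := ku _ h0; have [|N2 HN2] := @invS_le R (e / 2); first by rewrite divr_gt0.
  pose n := maxn N1 N2.
  have nk := HN1 n (leq_maxl _ _); have nd := HN2 n (leq_maxr _ _).
  have [_ un] := uP n.
  have -> : x - k = (x - u n) + (u n - k) by rewrite addrA subrK.
  rewrite nrmD_sqr; have := rip_le (x - u n) (u n - k).
  have := nrm_ge0 (x - u n); have := nrm_ge0 (u n - k).
  have n1 : n.+1%:R^-1 <= 1 :> R by rewrite invf_le1 ?ltr0n// ler1n.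
  move: (nrm (u n - k)) (nrm (x - u n)) (rip _ _) n.+1%:R^-1 nk un nd n1.
  move=> q a r j qh aD je j1 q0 a0 rqa.
  have qa : 2 * (a * q) <= h * (d + 2).
    have aq : 2 * a <= d + 2 by have := sqr_ge0 (a - 1); rewrite !expr2; lra.
    rewrite mulrCA mulrA mulrC; apply: ler_pM => //; lra.
  have qq : q ^+ 2 <= h by rewrite expr2 -[leRHS]mulr1 ler_pM// (le_trans qh).
  lra.
exists k => // y Ky.
have [->|y0] := eqVneq y 0; first by rewrite dot0r.
set w := x - k; set c := dot w y.
have yy : 0 < nrm y ^+ 2 by rewrite exprn_gt0// nrm_gt0.
pose s : R := (nrm y ^+ 2)^-1.
(* [s c] is the minimizing coefficient, that of the projection on [y] *)
have : nrm w ^+ 2 <= nrm (w - (s%:C * c) *: y) ^+ 2.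
  rewrite (le_trans kd)// /w -addrA -opprD dK// addrC; exact: KD.
rewrite (nrmB_sqr w) /rip dotZr -/c Re_conj_mul nrmZ normcM normc_real.
rewrite ger0_norm ?invr_ge0 ?(ltW yy)// !exprMn => le.
have : s * normc c ^+ 2 <= 0.
  have sy : s * nrm y ^+ 2 = 1 by rewrite mulVf// gt_eqF.
  have : s ^+ 2 * normc c ^+ 2 * nrm y ^+ 2 = s * normc c ^+ 2.
    by rewrite expr2 mulrAC -(mulrA s s) sy mulr1.
  by move: le; lra.
rewrite pmulr_rle0 ?invr_gt0// => c0.
apply/eq0_normc/eqP; rewrite -sqrf_eq0 eq_le c0 sqr_ge0//.
Qed.

Definition adjoint_pair A B := forall x y, dot (A x) y = dot x (B y).

Lemma adjoint_pairC A B : adjoint_pair A B -> adjoint_pair B A.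
Proof. by move=> AB x y; rewrite dotC -AB -dotC. Qed.

End InnerProduct.

(** * Bounded operators, norm and numerical radius *)

Section Bounded.
Variables (R : realType) (H : completeNormedModType R[i]).
Implicit Types (x y z : H) (a : R[i]) (A B C : H -> H).

Lemma linear_opD A : linear A -> forall x y, A (x + y) = A x + A y.
Proof. by move=> lA x y; rewrite -[x]scale1r lA !scale1r. Qed.
Lemma linear_op0 A : linear A -> A 0 = 0.
Proof. by move=> lA; apply: (addrI (A 0)); rewrite -linear_opD// !addr0. Qed.
Lemma linear_opZ A : linear A -> forall a x, A (a *: x) = a *: A x.
Proof. by move=> lA a x; rewrite -[a *: x]addr0 lA linear_op0// addr0. Qed.
Lemma linear_opN A : linear A -> forall x, A (- x) = - A x.
Proof. by move=> lA x; rewrite -scaleN1r linear_opZ// scaleN1r. Qed.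
Lemma linear_opB A : linear A -> forall x y, A (x - y) = A x - A y.
Proof. by move=> lA x y; rewrite linear_opD// linear_opN. Qed.

(** Norms have no imaginary part, so the complex constant of the definition can be
    replaced by a nonnegative real one. *)
Lemma bounded_operatorP A : bounded_operator A <->
  linear A /\ exists2 M : R, 0 <= M & forall x, nrm (A x) <= M * nrm x.
Proof.
split=> -[lA [M]]; last first.
  move=> _ AM; split=> //; exists M%:C => x.
  by rewrite !nrmE -rmorphM/= lecR.
move=> AM; split=> //; exists `|Re M| => // x.
have := AM x; rewrite !nrmE; case: M {AM} => b c; rewrite lecE => /andP[_] /=.
by rewrite mulr0 subr0 => /le_trans; apply; rewrite ler_wpM2r ?nrm_ge0 ?ler_norm.
Qed.

Lemma bounded_comp A B :
  bounded_operator A -> bounded_operator B -> bounded_operator (A \o B).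
Proof.
move=> /bounded_operatorP[lA [M M0 AM]] /bounded_operatorP[lB [N N0 BN]].
apply/bounded_operatorP; split=> [a x y|]; first by rewrite /= lB lA.
exists (M * N); first by rewrite mulr_ge0.
by move=> x /=; rewrite (le_trans (AM _))// -mulrA ler_wpM2l.
Qed.

Lemma bounded_lin a A B : bounded_operator A -> bounded_operator B ->
  bounded_operator (fun x => a *: A x + B x).
Proof.
move=> /bounded_operatorP[lA [M M0 AM]] /bounded_operatorP[lB [N N0 BN]].
apply/bounded_operatorP; split=> [b x y|].
  rewrite lB lA !scalerDr !scalerA (mulrC a b) -!addrA; congr (_ + _).
  by rewrite addrCA.
exists (normc a * M + N); first by rewrite addr_ge0// mulr_ge0// normc_ge0.
move=> x; rewrite (le_trans (nrmD _ _))// nrmZ mulrDl lerD//.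
by rewrite -mulrA ler_wpM2l ?normc_ge0.
Qed.

Lemma bounded_id : bounded_operator (fun x : H => x).
Proof.
by apply/bounded_operatorP; split=> //; exists 1 => // x; rewrite mul1r.
Qed.

Lemma bounded_scale a A : bounded_operator A -> bounded_operator (fun x => a *: A x).
Proof.
move=> bA; have [lA _] := bA.
have -> : (fun x => a *: A x) = (fun x => (a - 1) *: A x + A x).
  by apply/funext => x; rewrite -[X in _ + X]scale1r -scalerDl subrK.
exact: bounded_lin.
Qed.

Lemma bounded_add A B : bounded_operator A -> bounded_operator B ->
  bounded_operator (fun x => A x + B x).
Proof.
move=> bA bB; have -> : (fun x => A x + B x) = (fun x => 1 *: A x + B x).
  by apply/funext => x; rewrite scale1r.
exact: bounded_lin.
Qed.

Lemma bounded_sub A B : bounded_operator A -> bounded_operator B ->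
  bounded_operator (fun x => A x - B x).
Proof.
move=> bA bB; have -> : (fun x => A x - B x) = (fun x => (-1) *: B x + A x).
  by apply/funext => x; rewrite scaleN1r addrC.
exact: bounded_lin.
Qed.

Lemma opnorm_ge0 A : bounded_operator A -> 0 <= opnorm A.
Proof.
move=> /bounded_operatorP[lA [M M0 AM]].
apply: ub_le_sup; last by exists 0; rewrite /= ?normr0 ?linear_op0 ?normr0.
exists M => _ [x /= x1 <-].
rewrite (le_trans (AM x))// -[leRHS]mulr1 ler_wpM2l// -nrm_le//.
Qed.

Lemma opnorm_le A x : bounded_operator A -> nrm (A x) <= opnorm A * nrm x.
Proof.
move=> bA; have /bounded_operatorP[lA [M M0 AM]] := bA.
have [->|x0] := eqVneq x 0; first by rewrite linear_op0// nrm0 mulr0.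
rewrite -ler_pdivrMr ?nrm_gt0// mulrC.
have <- : nrm (A ((nrm x)^-1%:C *: x)) = (nrm x)^-1 * nrm (A x).
  by rewrite linear_opZ// nrmZ normc_real ger0_norm ?invr_ge0 ?nrm_ge0.
apply: ub_le_sup.
  exists M => _ [y /= y1 <-].
  by rewrite (le_trans (AM y))// -[leRHS]mulr1 ler_wpM2l// -nrm_le.
exists ((nrm x)^-1%:C *: x) => //=.
rewrite -[1]/(1%:C) nrm_le nrmZ normc_real ger0_norm ?invr_ge0 ?nrm_ge0//.
by rewrite mulVf// nrm_eq0.
Qed.

Lemma opnorm_ub A (M : R) :
  0 <= M -> (forall x, nrm (A x) <= M * nrm x) -> opnorm A <= M.
Proof.
move=> M0 AM; apply: ge_sup; first by exists (Re `|A 0|), 0; rewrite /= ?normr0.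
move=> _ [x /= x1 <-]; rewrite (le_trans (AM x))// -[leRHS]mulr1 ler_wpM2l//.
by rewrite -nrm_le.
Qed.

Section NumericalRadius.
Variable dot : {dot H for Num.conj}.
Hypothesis dotE : forall x : H, dot x x = `|x| ^+ 2.

Lemma numrad_le A x : bounded_operator A ->
  normc (dot (A x) x) <= numrad dot A * nrm x ^+ 2.
Proof.
move=> bA; have /bounded_operatorP[lA [M M0 AM]] := bA.
have [->|x0] := eqVneq x 0; first by rewrite dot0r normc0 nrm0 expr0n mulr0.
rewrite -ler_pdivrMr ?exprn_gt0 ?nrm_gt0// mulrC.
have <- : normc (dot (A ((nrm x)^-1%:C *: x)) ((nrm x)^-1%:C *: x)) =
    (nrm x ^+ 2)^-1 * normc (dot (A x) x).
  rewrite linear_opZ// dotZl dotZr conjc_real !normcM normc_real.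
  by rewrite ger0_norm ?invr_ge0 ?nrm_ge0// mulrA expr2 invfM.
apply: ub_le_sup.
  exists M => _ [y /= y1 <-]; change (normc (dot (A y) y) <= M).
  have ny : nrm y = 1 by rewrite /nrm y1.
  by rewrite (le_trans (cauchy_schwarz dotE _ _))// ny mulr1 (le_trans (AM _))// ny mulr1.
exists ((nrm x)^-1%:C *: x) => //=.
rewrite nrmE nrmZ normc_real ger0_norm ?invr_ge0 ?nrm_ge0//.
by rewrite mulVf// nrm_eq0.
Qed.

Lemma numrad_ub A (M : R) : (exists x : H, x != 0) ->
  (forall x, nrm x = 1 -> normc (dot (A x) x) <= M) -> numrad dot A <= M.
Proof.
move=> [x x0] AM; apply: ge_sup; last first.
  by move=> _ [y /= y1 <-]; apply: AM; rewrite /nrm y1.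
exists (Re `|dot (A ((nrm x)^-1%:C *: x)) ((nrm x)^-1%:C *: x)|).
exists ((nrm x)^-1%:C *: x) => //=.
rewrite nrmE nrmZ normc_real ger0_norm ?invr_ge0 ?nrm_ge0//.
by rewrite mulVf// nrm_eq0.
Qed.

Lemma numrad_ge0 A : bounded_operator A -> (exists x : H, x != 0) ->
  0 <= numrad dot A.
Proof.
move=> bA [x x0]; have := numrad_le x bA.
have /le_trans h := normc_ge0 (dot (A x) x); move/h.
by rewrite pmulr_lge0// exprn_gt0// nrm_gt0.
Qed.

End NumericalRadius.

(** * Riesz representation, adjoints and invertibility *)

Section Adjoint.
Variable dot : {dot H for Num.conj}.
Hypothesis dotE : forall x : H, dot x x = `|x| ^+ 2.

Lemma conjcM a b : conjc (a * b) = conjc a * conjc b.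
Proof. by case: a b => ? ? [? ?] /=; simpc; congr Complex; ring. Qed.

(** If [f] is not zero, it is determined by its kernel up to a scalar, and a
    vector [w] orthogonal to the kernel represents it after rescaling. *)
Lemma riesz (f : H -> R[i]) : (forall a x y, f (a *: x + y) = a * f x + f y) ->
  (exists2 M, 0 <= M & forall x, normc (f x) <= M * nrm x) ->
  exists w, forall x, f x = dot x w.
Proof.
move=> lf [M M0 fM].
have f0 : f 0 = 0.
  by apply/eq0_normc/eqP; rewrite eq_le normc_ge0 andbT -(mulr0 M) -(nrm0 H).
have fB x y : f (x - y) = f x - f y by rewrite addrC -scaleN1r lf mulN1r addrC.
have [f_eq0|] := pselect (forall x, f x = 0).
  by exists 0 => x; rewrite dot0r.
move=> /existsNP[v /eqP v0].
have [|||k fk orth] := projection dotE (K := [set x | f x = 0]) v.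
- by [].
- by move=> a y z /= fy fz; rewrite lf fy fz mulr0 addr0.
- move=> u l fu ul; apply: contrapT => /eqP fl.
  have fl0 : 0 < normc (f l).
    by rewrite lt_def normc_ge0 andbT; apply: contra fl => /eqP/eq0_normc/eqP.
  have M1 : 0 < M + 1 by rewrite ltr_wpDl.
  have [|N /(_ N (leqnn _))] := ul (normc (f l) / (2 * (M + 1))).
    by rewrite divr_gt0// mulr_gt0.
  rewrite nrm_distC ler_pdivlMr ?mulr_gt0// => le.
  have := fM (l - u N); rewrite fB fu subr0.
  by have := nrm_ge0 (l - u N); nra.
have fw : f (v - k) != 0 by rewrite fB fk subr0.
set w := v - k in orth fw.
have w0 : w != 0 by apply: contra fw => /eqP ->; rewrite f0.
exists ((conjc (f w) / dot w w) *: w) => x.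
have /orth : [set x | f x = 0] (x - (f x / f w) *: w).
  by rewrite /= addrC -scaleNr lf mulNr divfK// addrC subrr.
rewrite dotBr dotZr => /eqP; rewrite subr_eq0 => /eqP wx.
rewrite dotZr (dotC dot x w) wx.
have ww0 : dot w w != 0 by rewrite dot_nrm// (inj_eq (@complexI R)) sqrf_eq0 nrm_eq0.
have ww : conjc (dot w w) = dot w w by rewrite -dotC.
rewrite !conjcM !conjc_inv !conjcK ww.
by field; rewrite ww0 fw.
Qed.

(** [|B y|^2 = <A (B y), y> <= M |B y| |y|]. *)
Lemma nrm_adjoint_le A B (M : R) : adjoint_pair dot A B -> 0 <= M ->
  (forall x, nrm (A x) <= M * nrm x) -> forall x, nrm (B x) <= M * nrm x.
Proof.
move=> AB M0 AM y; have [->|By] := eqVneq (B y) 0.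
  by rewrite nrm0 mulr_ge0// nrm_ge0.
rewrite -(ler_pM2l (_ : 0 < nrm (B y))) ?nrm_gt0//.
rewrite -expr2 -(rip_nrm dotE) /rip -AB.
rewrite (le_trans (Re_le_normc _))// (le_trans (cauchy_schwarz dotE _ _))//.
by rewrite mulrA ler_wpM2r ?nrm_ge0// mulrC.
Qed.

Lemma adjoint_exists A : bounded_operator A ->
  exists2 B, bounded_operator B & adjoint_pair dot A B.
Proof.
move=> bA; have /bounded_operatorP[lA [M M0 AM]] := bA.
have /choice[B AB] (y : H) : exists w, forall x, dot (A x) y = dot x w.
  apply: riesz => [a x z|]; first by rewrite lA dotDl dotZl.
  exists (M * nrm y) => [|x]; first by rewrite mulr_ge0// nrm_ge0.
  rewrite (le_trans (cauchy_schwarz dotE _ _))// mulrAC.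
  by rewrite ler_wpM2r ?nrm_ge0.
have ABp : adjoint_pair dot A B by move=> x y; exact: AB.
exists B => //; apply/bounded_operatorP; split.
  move=> a x y; apply: (dot_extr dotE) => z.
  by rewrite dotDr dotZr -!ABp dotDr dotZr.
by exists M => //; exact: nrm_adjoint_le ABp M0 AM.
Qed.

Lemma adjointP A : bounded_operator A ->
  bounded_operator (adjoint dot A) /\ adjoint_pair dot A (adjoint dot A).
Proof.
move=> /adjoint_exists[B bB AB]; rewrite /adjoint; set P := [set _ | _].
by have /getPex : exists C, P C by exists B.
Qed.

(** Being out of the spectrum means that [A - z] is invertible in this sense. *)
Definition invertible_op A :=
  exists2 B, bounded_operator B & forall x, A (B x) = x /\ B (A x) = x.

(** A lower bound for [A] makes it injective with closed range; one for its
    adjoint makes the orthogonal complement of the range trivial. *)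
Lemma invertible_bounded_below A A' (c : R) :
  bounded_operator A -> adjoint_pair dot A A' -> 0 < c ->
  (forall x, c * nrm x <= nrm (A x)) -> (forall x, c * nrm x <= nrm (A' x)) ->
  invertible_op A.
Proof.
move=> bA AA' c0 cA cA'; have [lA _] := bA.
have surj y : exists x, A x = y.
  have [|||k [x _ <-] orth] := projection dotE (K := range A) y.
  - by exists 0 => //; rewrite linear_op0.
  - by move=> a _ _ [u _ <-] [v _ <-]; exists (a *: u + v) => //; rewrite lA.
  - move=> u l Ku ul.
    have /choice[v uv] n : exists v, A v = u n by have [v _ vE] := Ku n; exists v.
    (* preimages of a convergent sequence form a Cauchy sequence *)
    have [w vw] : exists w, nrm_cvg v w.
      apply: nrm_complete => e e0.
      have [|N HN] := ul (c * e / 2); first by rewrite divr_gt0// mulr_gt0.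
      exists N => m n Nm Nn; rewrite -(ler_pM2l c0) (le_trans (cA _))//.
      rewrite linear_opB// !uv.
      have -> : u m - u n = (u m - l) - (u n - l) by rewrite opprB addrA subrK.
      rewrite (le_trans (nrmB _ _))//; have := HN _ Nm; have := HN _ Nn; lra.
    exists w => //; apply/eqP; rewrite -subr_eq0 -nrm_eq0 eq_le nrm_ge0 andbT.
    apply/ler_addgt0Pr => e e0; rewrite add0r.
    have oA := opnorm_ge0 bA.
    have [|N HN] := vw (e / (2 * (opnorm A + 1))); first by rewrite divr_gt0//; lra.
    have [|N' HN'] := ul (e / 2); first by rewrite divr_gt0.
    pose n := maxn N N'.
    have := HN n (leq_maxl _ _); have := HN' n (leq_maxr _ _).
    have -> : A w - l = (u n - l) - A (v n - w).
      by rewrite linear_opB// uv opprB [RHS]addrC addrA subrK.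
    move=> h1; rewrite ler_pdivlMr; last lra.
    have := nrmB (u n - l) (A (v n - w)); have := opnorm_le (v n - w) bA.
    have := nrm_ge0 (v n - w); nra.
  exists x; apply/esym/eqP; rewrite -subr_eq0 -nrm_eq0.
  suff -> : nrm (y - A x) = 0 by [].
  have A'0 : A' (y - A x) = 0.
    apply: (dot_extr dotE) => z; rewrite dot0r -AA' dotC orth ?conjc0//; exists z.
  by apply/eqP; have := cA' (y - A x); rewrite A'0 nrm0 pmulr_rle0// eq_le nrm_ge0 andbT.
have [B AB] := choice surj.
have inj x y : A x = A y -> x = y.
  move=> Axy; apply/eqP; rewrite -subr_eq0 -nrm_eq0; have := cA (x - y).
  by rewrite linear_opB// Axy subrr nrm0 pmulr_rle0// eq_le nrm_ge0 andbT.
exists B; last by move=> x; split=> //; apply: inj.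
apply/bounded_operatorP; split.
  by move=> a x y; apply: inj; rewrite lA !AB.
exists c^-1; first by rewrite invr_ge0 ltW.
by move=> x; rewrite ler_pdivlMl// -{2}(AB x).
Qed.

End Adjoint.
End Bounded.

(** * Polynomials of an operator *)

Section PolynomialCalculus.
Variables (R : realType) (H : completeNormedModType R[i]).
Implicit Types (x y : H) (a z : R[i]) (A B C : H -> H) (p q : {poly R[i]}).

(** Allowing zero coefficients makes [oppoly] visibly additive. *)
Lemma oppoly_widen p A n x : (size p <= n)%N ->
  oppoly p A x = \sum_(i < n) p`_i *: iter i A x.
Proof.
move=> pn; rewrite /oppoly (big_ord_widen _ (fun i => p`_i *: iter i A x) pn).
rewrite big_mkcond; apply: eq_bigr => i _; case: ifPn => //.
by rewrite -leqNgt => /(nth_default 0) ->; rewrite scale0r.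
Qed.

Lemma oppolyD p q A x : oppoly (p + q) A x = oppoly p A x + oppoly q A x.
Proof.
pose n := maxn (size (p + q)) (maxn (size p) (size q)).
rewrite !(@oppoly_widen _ _ n) ?leq_max ?leqnn ?orbT// -big_split/=.
by apply: eq_bigr => i _; rewrite coefD scalerDl.
Qed.

Lemma oppolyZ a p A x : oppoly (a *: p) A x = a *: oppoly p A x.
Proof.
pose n := maxn (size (a *: p)) (size p).
rewrite !(@oppoly_widen _ _ n) ?leq_max ?leqnn ?orbT// scaler_sumr.
by apply: eq_bigr => i _; rewrite coefZ scalerA.
Qed.

Lemma oppolyN p A x : oppoly (- p) A x = - oppoly p A x.
Proof. by rewrite -scaleN1r oppolyZ scaleN1r. Qed.

Lemma oppolyB p q A x : oppoly (p - q) A x = oppoly p A x - oppoly q A x.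
Proof. by rewrite oppolyD oppolyN. Qed.

Lemma oppolyC a A x : oppoly a%:P A x = a *: x.
Proof.
by rewrite (@oppoly_widen _ _ 1) ?size_polyC_leq1// big_ord1/= coefC.
Qed.

Lemma oppolyMX p A x : oppoly (p * 'X) A x = oppoly p A (A x).
Proof.
rewrite (@oppoly_widen _ _ (size p).+1) ?size_mul_leq; last first.
  by rewrite (leq_trans (size_polyMleq _ _))// size_polyX addn2.
rewrite big_ord_recl coefMX/= scale0r add0r; apply: eq_bigr => i _.
by rewrite coefMX/= -iterSr.
Qed.

Lemma oppolyX A x : oppoly 'X A x = A x.
Proof. by rewrite -['X]mul1r oppolyMX -[1]/(1%:P) oppolyC scale1r. Qed.

Lemma oppoly_linear p A : linear A -> linear (oppoly p A).
Proof.
move=> lA a x y; elim/poly_ind: p x y => [|p c IH] x y.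
  by rewrite -[0]/(0%:P) !oppolyC !scale0r scaler0 addr0.
rewrite !oppolyD !oppolyMX !oppolyC lA IH !scalerDr !scalerA (mulrC c a).
by rewrite -!addrA; congr (_ + _); rewrite addrCA.
Qed.

Lemma oppoly_comm p A x : linear A -> oppoly p A (A x) = A (oppoly p A x).
Proof.
move=> lA; elim/poly_ind: p x => [|p c IH] x.
  by rewrite -[0]/(0%:P) !oppolyC !scale0r linear_op0.
by rewrite !oppolyD !oppolyMX !oppolyC IH (linear_opD lA) (linear_opZ lA).
Qed.

Lemma oppolyM p q A x : linear A -> oppoly (p * q) A x = oppoly p A (oppoly q A x).
Proof.
move=> lA; elim/poly_ind: q x => [|q c IH] x.
  rewrite mulr0 -[0]/(0%:P) !oppolyC !scale0r linear_op0//.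
  exact: oppoly_linear.
rewrite mulrDr mulrA oppolyD oppolyMX IH oppolyD oppolyMX oppolyC.
rewrite (linear_opD (oppoly_linear p lA)) (linear_opZ (oppoly_linear p lA)).
by rewrite mulrC mul_polyC oppolyZ.
Qed.

Lemma oppoly_bounded p A : bounded_operator A -> bounded_operator (oppoly p A).
Proof.
move=> bA; elim/poly_ind: p => [|p c IH].
  have -> : oppoly 0 A = fun x => 0 *: x.
    by apply/funext => x; rewrite -[0]/(0%:P) oppolyC.
  exact: bounded_scale (bounded_id _).
have -> : oppoly (p * 'X + c%:P) A = fun x => c *: x + (oppoly p A \o A) x.
  by apply/funext => x; rewrite oppolyD oppolyMX oppolyC addrC.
exact: bounded_lin (bounded_id _) (bounded_comp IH bA).
Qed.

Variable dot : {dot H for Num.conj}.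
Hypothesis dotE : forall x : H, dot x x = `|x| ^+ 2.

Definition conj_poly p : {poly R[i]} := map_poly (@conjc R) p.

Lemma oppoly_adjoint p A : linear A -> adjoint_pair dot A A ->
  adjoint_pair dot (oppoly p A) (oppoly (conj_poly p) A).
Proof.
move=> lA AA x y; elim/poly_ind: p x y => [|p c IH] x y.
  rewrite /conj_poly rmorph0 -[0]/(0%:P) !oppolyC !scale0r dot0l dot0r//.
rewrite /conj_poly rmorphD rmorphM/= map_polyX map_polyC/= -/(conj_poly p).
rewrite !oppolyD !oppolyMX !oppolyC dotDl dotDr IH dotZl dotZr conjcK.
by rewrite AA oppoly_comm.
Qed.

Lemma invertible_comp A B : invertible_op A -> invertible_op B ->
  invertible_op (A \o B).
Proof.
move=> [A' bA' AA'] [B' bB' BB']; exists (B' \o A'); first exact: bounded_comp.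
move=> x /=; have [h1 h2] := AA' x; have [h3 h4] := BB' (A' x).
by have [_ h5] := AA' (B x); have [_ h6] := BB' x; rewrite h3 h1 h5 h6.
Qed.

Lemma invertible_scale a A : a != 0 -> linear A -> invertible_op A ->
  invertible_op (fun x => a *: A x).
Proof.
move=> a0 lA [B bB AB]; exists (fun x => a^-1 *: B x); first exact: bounded_scale.
move=> x; have [h1 h2] := AB x; have [lB _] := bB.
by rewrite (linear_opZ lA) (linear_opZ lB) h1 h2 !scalerA mulfV// mulVf// !scale1r.
Qed.

(** Half of the spectral mapping theorem: over the complex numbers [p] splits into
    linear factors, so [p(A)] is a product of invertible operators. *)
Lemma invertible_oppoly p A : bounded_operator A -> p != 0 ->
  (forall z, root p z -> ~ spectrum A z) -> invertible_op (oppoly p A).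
Proof.
move=> bA p0 Hp; have [lA _] := bA.
have [r pE] := closed_field_poly_normal p.
have Hr z : z \in r -> ~ spectrum A z.
  move=> zr; apply: Hp; rewrite pE rootZ ?lead_coef_eq0//.
  by rewrite root_prod_XsubC.
have -> : oppoly p A = fun x => lead_coef p *: oppoly (\prod_(z <- r) ('X - z%:P)) A x.
  by apply/funext => x; rewrite -oppolyZ -pE.
apply: invertible_scale; rewrite ?lead_coef_eq0//; first exact: oppoly_linear.
elim: r Hr {pE} => [_|z r IH Hr].
  rewrite big_nil; exists (fun x => x); first exact: bounded_id.
  by move=> x; rewrite -[1]/(1%:P) !oppolyC !scale1r.
rewrite big_cons.
have -> : oppoly (('X - z%:P) * \prod_(j <- r) ('X - j%:P)) A =
   (fun x => A x - z *: x) \o oppoly (\prod_(j <- r) ('X - j%:P)) A.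
  by apply/funext => x; rewrite oppolyM// oppolyB oppolyX oppolyC.
apply: invertible_comp; last by apply: IH => w wr; apply: Hr; rewrite inE wr orbT.
by apply: contrapT => nz; apply: (Hr z); rewrite ?mem_head.
Qed.

(** * Spectrum of self-adjoint operators *)

Definition selfadjoint A := bounded_operator A /\ adjoint_pair dot A A.

Lemma adjoint_pair_shift A z : adjoint_pair dot A A ->
  adjoint_pair dot (fun x => A x - z *: x) (fun x => A x - conjc z *: x).
Proof. by move=> AA x y; rewrite dotBl dotBr dotZl dotZr conjcK AA. Qed.

Lemma bounded_shift A z : bounded_operator A -> bounded_operator (fun x => A x - z *: x).
Proof. by move=> bA; apply: bounded_sub => //; apply: bounded_scale (bounded_id _). Qed.

Lemma dot_selfadjoint_real A x : adjoint_pair dot A A -> Im (dot (A x) x) = 0.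
Proof.
move=> AA; have : dot (A x) x = conjc (dot (A x) x) by rewrite -dotC AA.
by case: (dot (A x) x) => b c /= [] ?; lra.
Qed.

(** [|<(A - w) x, x>| >= |Im w| |x|^2], because [<A x, x>] is real. *)
Lemma spectrum_real A z : selfadjoint A -> spectrum A z -> Im z = 0.
Proof.
move=> [bA AA] Az; apply/eqP; apply: contrapT => /negP z0; apply: Az.
have below w x : Im w != 0 -> `|Im w| * nrm x <= nrm (A x - w *: x).
  move=> w0; have [->|x0] := eqVneq x 0; first by rewrite nrm0 mulr0 nrm_ge0.
  rewrite -(ler_pM2r (_ : 0 < nrm x)) ?nrm_gt0//.
  rewrite (le_trans _ (cauchy_schwarz dotE _ _))//.
  rewrite dotBl dotZl dot_nrm// -mulrA -expr2.
  have -> : `|Im w| * nrm x ^+ 2 = `|Im (dot (A x) x - w * (nrm x ^+ 2)%:C)|.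
    rewrite raddfB/= (dot_selfadjoint_real _ AA) sub0r normrN.
    case: w {w0} => b c /=; rewrite mulr0 add0r normrM.
    by rewrite [X in _ = _ * X]ger0_norm ?sqr_ge0.
  move: (_ - _) => a; rewrite -ler_sqr ?nnegrE ?normc_ge0// normc_sqr.
  by rewrite real_normK ?num_real// lerDr sqr_ge0.
apply: (invertible_bounded_below dotE (bounded_shift z bA)
  (adjoint_pair_shift z AA) (_ : 0 < `|Im z|)).
- by rewrite normr_gt0.
- by move=> x; apply: below.
- move=> x; have := below (conjc z) x.
  by case: (z) z0 => b c /=; rewrite oppr_eq0 normrN => c0; apply.
Qed.

Lemma spectrum_bounded A z : selfadjoint A -> spectrum A z -> normc z <= opnorm A.
Proof.
move=> [bA AA] Az; rewrite leNgt; apply/negP => zA; apply: Az.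
have below w x : normc w = normc z ->
   (normc z - opnorm A) * nrm x <= nrm (A x - w *: x).
  move=> wz; rewrite mulrBl -wz -nrmZ nrm_distC.
  have := nrmD (w *: x - A x) (A x); rewrite subrK; have := opnorm_le x bA; lra.
apply: (invertible_bounded_below dotE (bounded_shift z bA)
  (adjoint_pair_shift z AA) (_ : 0 < normc z - opnorm A)).
- by rewrite subr_gt0.
- by move=> x; apply: below.
- by move=> x; apply: below; case: (z) => b c /=; rewrite sqrrN.
Qed.

(** If [Re z < 0], then [Re <(A - z) x, x> >= - Re z |x|^2]. *)
Lemma spectrum_ge0 A z : selfadjoint A -> (forall x, 0 <= rip dot (A x) x) ->
  spectrum A z -> 0 <= Re z.
Proof.
move=> sA A0 Az; have zR := spectrum_real sA Az; have [bA AA] := sA.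
rewrite leNgt; apply/negP => z0; apply: Az.
have zE : conjc z = z by case: (z) zR => b c /= ->; rewrite oppr0.
have below x : - Re z * nrm x <= nrm (A x - z *: x).
  have [->|x0] := eqVneq x 0; first by rewrite nrm0 mulr0 nrm_ge0.
  rewrite -(ler_pM2r (_ : 0 < nrm x)) ?nrm_gt0//.
  rewrite (le_trans _ (rip_le dotE _ _))// -mulrA -expr2.
  have -> : z = (Re z)%:C by case: (z) zR => b c /= ->.
  rewrite ripDl ripNl ripZl rip_nrm//=; have := A0 x; lra.
apply: (invertible_bounded_below dotE (bounded_shift z bA)
  (adjoint_pair_shift z AA) (_ : 0 < - Re z)).
- by rewrite oppr_gt0.
- exact: below.
- by rewrite zE.
Qed.

End PolynomialCalculus.

(** * Continuous functional calculus *)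

Section FunctionalCalculus.
Variables (R : realType) (H : completeNormedModType R[i]).
Implicit Types (x y : H) (a z : R[i]) (A B C D : H -> H) (p q : {poly R[i]}).
Implicit Types (f g h : R[i] -> R[i]).

Variable dot : {dot H for Num.conj}.
Hypothesis dotE : forall x : H, dot x x = `|x| ^+ 2.
Hypothesis H_neq0 : exists x : H, x != 0.

Lemma le_normcB a z : normc (a - z) <= normc a + normc z.
Proof. by rewrite -(normcN z) le_normcD. Qed.

Lemma conj_poly_real p z : Im z = 0 -> (conj_poly p).[z] = conjc p.[z].
Proof.
move=> z0; rewrite -horner_map/=; congr (_.[_]).
by case: z z0 => b c /= ->; rewrite oppr0.
Qed.

(** At a self-adjoint [A], this is [p(A)^* p(A) - ||p(A)||^2]. *)
Definition norm_defect A p : {poly R[i]} :=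
  conj_poly p * p - ((opnorm (oppoly p A)) ^+ 2)%:C%:P.

(** With [N = p(A)] and [m = ||N||],
    [||(N^* N - m^2) x||^2 <= m^2 (m^2 ||x||^2 - ||N x||^2)]. If [N^* N - m^2] were
    bounded below, then [||N x||^2 <= (m^2 - d) ||x||^2] for some [d > 0], contrary
    to the choice of [m]. *)
Lemma norm_defect_not_invertible A p : selfadjoint dot A ->
  ~ invertible_op (oppoly (norm_defect A p) A).
Proof.
move=> [bA AA] [B bB BQ]; have [lA _] := bA.
have /bounded_operatorP[lB [K K0 BK]] := bB.
set m := opnorm (oppoly p A) in BQ *.
have bN := oppoly_bounded p bA.
have m0 : 0 <= m := opnorm_ge0 bN.
have NN' := oppoly_adjoint p lA AA.
(* the summand [1] makes [K1] positive even if [m = 0] *)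
pose K1 := K ^+ 2 * m ^+ 2 + 1.
have K10 : 0 < K1 by rewrite ltr_wpDl// mulr_ge0// sqr_ge0.
have Nx x : nrm (oppoly p A x) ^+ 2 <= (m ^+ 2 - K1^-1) * nrm x ^+ 2.
  set y := oppoly (norm_defect A p) A x.
  have xy : nrm x ^+ 2 <= K ^+ 2 * nrm y ^+ 2.
    rewrite -exprMn lerXn2r ?nnegrE ?nrm_ge0 ?mulr_ge0 ?nrm_ge0//.
    by have [_ {1}<-] := BQ x; exact: BK.
  have yE : y = oppoly (conj_poly p) A (oppoly p A x) - (m ^+ 2)%:C *: x.
    by rewrite /y oppolyB oppolyM// oppolyC.
  have y2 : nrm y ^+ 2 <= m ^+ 2 * (m ^+ 2 * nrm x ^+ 2 - nrm (oppoly p A x) ^+ 2).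
    rewrite yE (nrmB_sqr dotE) ripZr /rip (adjoint_pairC NN') -/(rip dot _ _) rip_nrm//.
    rewrite nrmZ normc_real ger0_norm ?sqr_ge0//.
    have : nrm (oppoly (conj_poly p) A (oppoly p A x)) ^+ 2 <=
        m ^+ 2 * nrm (oppoly p A x) ^+ 2.
      rewrite -exprMn lerXn2r ?nnegrE ?nrm_ge0 ?mulr_ge0 ?nrm_ge0//.
      apply: (nrm_adjoint_le dotE NN') => // u.
      exact: opnorm_le.
    by lra.
  have a0 : 0 <= m ^+ 2 * nrm x ^+ 2 - nrm (oppoly p A x) ^+ 2.
    rewrite subr_ge0 -exprMn lerXn2r ?nnegrE ?nrm_ge0 ?mulr_ge0 ?nrm_ge0//.
    exact: opnorm_le.
  have : nrm x ^+ 2 <= K1 * (m ^+ 2 * nrm x ^+ 2 - nrm (oppoly p A x) ^+ 2).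
    rewrite /K1 mulrDl mul1r -mulrA.
    by have := ler_wpM2l (sqr_ge0 K) y2; lra.
  by rewrite -ler_pdivrMl// mulrBl; lra.
have [x0 x00] := H_neq0.
have d0 : 0 <= m ^+ 2 - K1^-1.
  rewrite -(pmulr_lge0 (x := nrm x0 ^+ 2)) ?exprn_gt0 ?nrm_gt0//.
  by rewrite (le_trans _ (Nx x0))// sqr_ge0.
have : m <= Num.sqrt (m ^+ 2 - K1^-1).
  apply: opnorm_ub; first exact: sqrtr_ge0.
  move=> x; rewrite -(@ler_pXn2r _ 2)// ?nnegrE ?nrm_ge0 ?mulr_ge0 ?sqrtr_ge0 ?nrm_ge0//.
  by rewrite exprMn sqr_sqrtr.
rewrite -(@ler_pXn2r _ 2)// ?nnegrE ?sqrtr_ge0// sqr_sqrtr//.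
by rewrite lerBrDr gerDl leNgt invr_gt0 K10.
Qed.

Lemma spectrum_defect_root A p : selfadjoint dot A -> norm_defect A p != 0 ->
  exists2 z, spectrum A z & root (norm_defect A p) z.
Proof.
move=> sA Q0; apply: contrapT => noz.
apply: (norm_defect_not_invertible (p := p) sA).
apply: invertible_oppoly => //; first by case: sA.
by move=> z rz Az; apply: noz; exists z.
Qed.

(** The norm defect of the polynomial ['X] has degree [2], so it does not vanish. *)
Lemma spectrum_nonempty A : selfadjoint dot A -> exists z, spectrum A z.
Proof.
move=> sA; have [|z Az _] := @spectrum_defect_root A 'X sA; last by exists z.
apply/eqP => /(congr1 (fun p : {poly R[i]} => p`_2)).
rewrite /norm_defect /conj_poly map_polyX coefB coefMX coefX coefC coef0 subr0 /=.
by apply/eqP; rewrite oner_eq0.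
Qed.

(** At a point [z] of the spectrum, which is real, the norm defect of [p] takes
    the value [|p z|^2 - ||p(A)||^2]. If it is the zero polynomial, any point of
    the spectrum will do. *)
Lemma opnorm_oppoly_spectrum A p : selfadjoint dot A ->
  exists2 z, spectrum A z & normc p.[z] = opnorm (oppoly p A).
Proof.
move=> sA; have bA : bounded_operator A by case: sA.
have [z Az rz] : exists2 z, spectrum A z & root (norm_defect A p) z.
  have [Q0|] := eqVneq (norm_defect A p) 0; last exact: spectrum_defect_root.
  by have [z Az] := spectrum_nonempty sA; exists z => //; rewrite Q0 root0.
exists z => //; move: rz.
rewrite /root /norm_defect !hornerE conj_poly_real ?(spectrum_real dotE sA)//.
rewrite mulrC -sqr_normc norm_normc -rmorphXn -rmorphB (inj_eq (@complexI R) _ 0).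
rewrite subr_eq0 eqrXn2 ?normc_ge0//; first by move/eqP.
exact/opnorm_ge0/oppoly_bounded.
Qed.

Lemma oppoly_norm_le A p (e : R) : selfadjoint dot A ->
  (forall z, spectrum A z -> normc p.[z] <= e) ->
  forall x, nrm (oppoly p A x) <= e * nrm x.
Proof.
move=> sA pe x; have bA : bounded_operator A by case: sA.
have [z Az zE] := opnorm_oppoly_spectrum p sA.
rewrite (le_trans (opnorm_le _ (oppoly_bounded _ bA)))// ler_wpM2r ?nrm_ge0//.
by rewrite -zE pe.
Qed.

(** [B] is a value of [f(A)]. Asking for one polynomial per tolerance, instead of
    a sequence that converges in both senses, is equivalent and lets the algebraic
    rules be proved by a single estimate each. *)
Definition cfc_rel f A B := bounded_operator B /\
  forall e : R, 0 < e -> exists p,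
    (forall z, spectrum A z -> normc (p.[z] - f z) <= e) /\
    (forall x, nrm (oppoly p A x - B x) <= e * nrm x).

Lemma small_eq0 x (K : R) : (forall e, 0 < e -> e <= 1 -> nrm x <= e * K) -> x = 0.
Proof.
move=> xK; apply/eqP; rewrite -nrm_eq0 eq_le nrm_ge0 andbT.
apply/ler_addgt0Pr => e e0; rewrite add0r.
have D0 : 0 < `|K| + e by have := normr_ge0 K; lra.
have le1 : e / (`|K| + e) <= 1.
  by rewrite ler_pdivrMr// mul1r; have := normr_ge0 K; lra.
have := xK _ (divr_gt0 e0 D0) le1.
move/le_trans; apply; rewrite mulrAC ler_pdivrMr// ler_wpM2l ?(ltW e0)//.
by have := ler_norm K; lra.
Qed.

(** The functional calculus picks such a value as soon as there is one. *)
Lemma cfc_rel_cfc f A B : bounded_operator A -> cfc_rel f A B -> cfc_rel f A (cfc f A).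
Proof.
move=> bA [bB HB]; rewrite /cfc; set P := [set _ | _].
have /getPex[bC [p pf pC]] : exists C, P C.
  have /choice[p pP] (n : nat) : exists p,
      (forall z, spectrum A z -> normc (p.[z] - f z) <= n.+1%:R^-1) /\
      (forall x, nrm (oppoly p A x - B x) <= n.+1%:R^-1 * nrm x).
    by apply: HB; exact: invS_gt0.
  exists B; split=> //; exists p.
    move=> e e0; have [N HN] := invS_le e0; exists N => // n /= Nn z Az.
    rewrite norm_normc lecR; have [+ _] := pP n; move/(_ z Az)/le_trans; apply.
    exact: HN.
  apply/cvgrPdist_le => e e0; have [N HN] := invS_le e0; exists N => // n /= Nn.
  have [_ le] := pP n.
  rewrite sub0r normrN ger0_norm.
    by rewrite (le_trans (opnorm_ub _ le) (HN n Nn))// ltW// invS_gt0.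
  rewrite (le_trans (nrm_ge0 ((oppoly (p n) A 0) - B 0)))//.
  apply: ub_le_sup; last by exists 0 => //=; rewrite normr0.
  exists n.+1%:R^-1 => _ [x /= x1 <-].
  by rewrite (le_trans (le x))// -[leRHS]mulr1 ler_wpM2l ?(ltW (invS_gt0 R _))// -nrm_le.
split=> // e e0.
have [N1 _ HN1] := pf _ e0.
move/cvgrPdist_le : pC => /(_ _ e0)[N2 _ HN2].
pose n := maxn N1 N2; exists (p n); split.
  by move=> z Az; rewrite -lecR -norm_normc; apply: HN1 => //=; exact: leq_maxl.
move=> x; have := HN2 n (leq_maxr _ _); rewrite /= sub0r normrN => le.
have bC' := bounded_sub (oppoly_bounded (p n) bA) bC.
apply: le_trans (opnorm_le x bC') _; rewrite ler_wpM2r ?nrm_ge0//.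
exact: le_trans (ler_norm _) le.
Qed.

(** The approximating polynomials are close on the spectrum, hence at [A]. *)
Lemma cfc_rel_unique f g A B C : selfadjoint dot A ->
  (forall z, spectrum A z -> f z = g z) ->
  cfc_rel f A B -> cfc_rel g A C -> B = C.
Proof.
move=> sA fg [_ HB] [_ HC]; apply/funext => x; apply/eqP; rewrite -subr_eq0.
apply/eqP; apply: (@small_eq0 _ (4 * nrm x)) => e e0 _.
have [p [pf pB]] := HB _ e0; have [q [qg qC]] := HC _ e0.
have pq : nrm (oppoly (p - q) A x) <= 2 * e * nrm x.
  apply: oppoly_norm_le sA _ x => z Az; rewrite hornerD hornerN.
  have -> : p.[z] - q.[z] = (p.[z] - f z) - (q.[z] - g z) by rewrite (fg z Az); ring.
  rewrite (le_trans (le_normcB _ _))//.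
  by have := pf z Az; have := qg z Az; lra.
have -> : B x - C x = (B x - oppoly p A x) + oppoly (p - q) A x + (oppoly q A x - C x).
  by rewrite oppolyB !addrA !subrK.
have := nrmD ((B x - oppoly p A x) + oppoly (p - q) A x) (oppoly q A x - C x).
have := nrmD (B x - oppoly p A x) (oppoly (p - q) A x).
by rewrite (nrm_distC (B x)); have := pB x; have := qC x; lra.
Qed.

Lemma cfc_rel_mul f g h A B C D (F G : R) : selfadjoint dot A ->
  (forall z, spectrum A z -> normc (f z) <= F /\ normc (g z) <= G) ->
  (forall z, spectrum A z -> f z * g z = h z) ->
  cfc_rel f A B -> cfc_rel g A C -> cfc_rel h A D -> forall x, B (C x) = D x.
Proof.
move=> sA FG fg [bB HB] [bC HC] [_ HD] x; have [bA _] := sA.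
have [lB _] := bB.
apply/eqP; rewrite -subr_eq0; apply/eqP.
apply: (@small_eq0 _ ((opnorm B + opnorm C + F + G + 4) * nrm x)) => e e0 e1.
have [p [pf pB]] := HB _ e0; have [q [qg qC]] := HC _ e0.
have [r [rh rD]] := HD _ e0.
have pqr : nrm (oppoly (p * q - r) A x) <= (F + G + 2) * e * nrm x.
  apply: oppoly_norm_le sA _ x => z Az; rewrite hornerD hornerN hornerM.
  have -> : p.[z] * q.[z] - r.[z] =
      (p.[z] - f z) * (q.[z] - g z) + ((p.[z] - f z) * g z + f z * (q.[z] - g z))
      - (r.[z] - h z) by rewrite -(fg z Az); ring.
  rewrite (le_trans (le_normcB _ _))//.
  have [fF gG] := FG z Az; have := rh z Az.
  have := le_normcD ((p.[z] - f z) * (q.[z] - g z)) ((p.[z] - f z) * g z + f z * (q.[z] - g z)).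
  have := le_normcD ((p.[z] - f z) * g z) (f z * (q.[z] - g z)).
  rewrite !normcM.
  have := pf z Az; have := qg z Az.
  have := normc_ge0 (p.[z] - f z); have := normc_ge0 (q.[z] - g z).
  have := normc_ge0 (f z); have := normc_ge0 (g z).
  move: (normc (p.[z] - f z)) (normc (q.[z] - g z)) (normc (f z)) (normc (g z)) fF gG.
  move=> a b c d cF dG d0 c0 b0 a0 be ae.
  have : a * b <= e * 1 by apply: ler_pM => //; lra.
  have : a * d <= e * G by apply: ler_pM.
  have : c * b <= F * e by apply: ler_pM.
  lra.
have lA : linear A by case: bA.
have -> : B (C x) - D x = B (C x - oppoly q A x)
    + (B (oppoly q A x) - oppoly p A (oppoly q A x))
    + oppoly (p * q - r) A x + (oppoly r A x - D x).
  by rewrite oppolyB oppolyM// (linear_opB lB) !addrA !subrK.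
have h1 := qC x; have h2 := rD x.
have h3 := pB (oppoly q A x); have h4 := opnorm_le (C x - oppoly q A x) bB.
have h5 := opnorm_le x bC; have h7 := opnorm_ge0 bB; have n0 := nrm_ge0 x.
have h6 : nrm (oppoly q A x) <= (opnorm C + 1) * nrm x.
  have := nrmD (oppoly q A x - C x) (C x); rewrite subrK.
  have : e * nrm x <= 1 * nrm x by rewrite ler_wpM2r.
  by lra.
have h8 : opnorm B * nrm (oppoly q A x - C x) <= opnorm B * (e * nrm x).
  by rewrite ler_wpM2l.
have h9 : e * nrm (oppoly q A x) <= e * ((opnorm C + 1) * nrm x).
  by rewrite ler_wpM2l// ltW.
rewrite nrm_distC in h3; rewrite (nrm_distC (C x)) in h4.
set u1 := B (C x - _) in h4 *; set u2 := B _ - _ in h3 *.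
set u3 := oppoly (_ - _) A x in pqr *; set u4 := oppoly r A x - _ in h2 *.
have := nrmD (u1 + u2 + u3) u4; have := nrmD (u1 + u2) u3; have := nrmD u1 u2.
by lra.
Qed.



(** Conjugating the coefficients of polynomials that approximate [f] gives an
    approximation of [conjc f = f] by polynomials whose values at [A] tend to the
    adjoint of [B]. *)
Lemma cfc_rel_selfadjoint f A B : selfadjoint dot A ->
  (forall z, spectrum A z -> conjc (f z) = f z) -> cfc_rel f A B -> selfadjoint dot B.
Proof.
move=> sA fr fB; have [bB HB] := fB; have [bA AA] := sA; have [lA _] := bA.
have [B' bB' BB'] := adjoint_exists dotE bB.
suff BE : B = B' by split=> //; rewrite {2}BE.
apply: (cfc_rel_unique sA (fun z _ => erefl (f z)) fB).
split=> // e e0; have [p [pf pB]] := HB _ e0.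
exists (conj_poly p); split=> [z Az|].
  rewrite conj_poly_real ?(spectrum_real dotE sA)// -fr//.
  have -> : conjc p.[z] - conjc (f z) = conjc (p.[z] - f z).
    case: (p.[z]) (f z) => a b [c d]; apply/eqP; rewrite eq_complex /=.
    by apply/andP; split; apply/eqP; ring.
  by have := pf z Az; case: (_ - _) => b c /=; rewrite sqrrN.
apply: (@nrm_adjoint_le _ _ dot dotE (fun x => oppoly p A x - B x)) => //.
- by move=> x y; rewrite dotBl dotBr BB' oppoly_adjoint.
- exact: ltW.
Qed.

Lemma cfc_rel_norm f A B (M : R) : selfadjoint dot A ->
  (forall z, spectrum A z -> normc (f z) <= M) -> cfc_rel f A B ->
  forall x, nrm (B x) <= M * nrm x.
Proof.
move=> sA fM [_ HB] x; apply/ler_addgt0Pr => e e0.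
have n1 : 0 < 2 * (nrm x + 1) by have := nrm_ge0 x; lra.
pose d := e / (2 * (nrm x + 1)); have d0 : 0 < d by rewrite divr_gt0.
have [p [pf pB]] := HB _ d0.
have px : nrm (oppoly p A x) <= (M + d) * nrm x.
  apply: (oppoly_norm_le sA) => z Az.
  have -> : p.[z] = (p.[z] - f z) + f z by rewrite subrK.
  by rewrite (le_trans (le_normcD _ _))//; have := pf z Az; have := fM z Az; lra.
have := pB x; rewrite nrm_distC.
have := nrmD (B x - oppoly p A x) (oppoly p A x); rewrite subrK.
have : d * (2 * (nrm x + 1)) = e by rewrite divfK// gt_eqF.
lra.
Qed.

Lemma cfc_rel_id f A : bounded_operator A -> (forall z, spectrum A z -> f z = z) ->
  cfc_rel f A A.
Proof.
move=> bA fz; split=> // e e0; exists 'X; split=> [z Az|x].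
  by rewrite hornerX fz// subrr normc0 ltW.
by rewrite oppolyX subrr nrm0 mulr_ge0 ?nrm_ge0 ?ltW.
Qed.

(** Polynomials that are uniformly Cauchy on the spectrum are Cauchy at [A], and the
    space of bounded operators is complete. *)
Lemma cfc_rel_exists f A : selfadjoint dot A ->
  (forall e : R, 0 < e -> exists p : {poly R[i]},
     forall z, spectrum A z -> normc (p.[z] - f z) <= e) ->
  exists B, cfc_rel f A B.
Proof.
move=> sA f_approx; have [bA _] := sA; have [lA _] := bA.
have /choice[p pf] (n : nat) : exists p : {poly R[i]},
    forall z, spectrum A z -> normc (p.[z] - f z) <= n.+1%:R^-1.
  by apply: f_approx; exact: invS_gt0.
have pmn m n x : nrm (oppoly (p m) A x - oppoly (p n) A x) <=
    (m.+1%:R^-1 + n.+1%:R^-1) * nrm x.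
  rewrite -oppolyB; apply: (oppoly_norm_le sA) => z Az; rewrite hornerD hornerN.
  have -> : (p m).[z] - (p n).[z] = ((p m).[z] - f z) - ((p n).[z] - f z) by ring.
  by rewrite (le_trans (le_normcB _ _))// lerD// pf.
have /choice[B Blim] (x : H) : exists l, nrm_cvg (fun n => oppoly (p n) A x) l.
  apply: nrm_complete => e e0.
  have n1 : 0 < 2 * (nrm x + 1) by have := nrm_ge0 x; lra.
  have [|N HN] := invS_le (_ : 0 < e / (2 * (nrm x + 1))); first by rewrite divr_gt0.
  exists N => m n Nm Nn; rewrite (le_trans (pmn m n x))//.
  have := HN _ Nm; have := HN _ Nn; rewrite !ler_pdivlMr// => h1 h2.
  have := invS_gt0 R m; have := invS_gt0 R n.
  move: (m.+1%:R^-1) (n.+1%:R^-1) h1 h2 => i j; have := nrm_ge0 x; lra.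
have pB n x : nrm (oppoly (p n) A x - B x) <= 2 * n.+1%:R^-1 * nrm x.
  apply/ler_addgt0Pr => e e0; have [N HN] := Blim x _ e0.
  pose m := maxn n N.
  have mn : m.+1%:R^-1 <= n.+1%:R^-1 :> R.
    by rewrite lef_pV2 ?posrE ?ltr0n// ler_nat ltnS leq_maxl.
  have -> : oppoly (p n) A x - B x = (oppoly (p n) A x - oppoly (p m) A x)
      + (oppoly (p m) A x - B x) by rewrite addrA subrK.
  have := nrmD (oppoly (p n) A x - oppoly (p m) A x) (oppoly (p m) A x - B x).
  have := HN m (leq_maxr _ _); have := pmn n m x.
  have : m.+1%:R^-1 * nrm x <= n.+1%:R^-1 * nrm x by rewrite ler_wpM2r ?nrm_ge0.
  move: (m.+1%:R^-1) (n.+1%:R^-1) => i j; lra.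
have lB : linear B.
  move=> a x y; apply/eqP; rewrite -subr_eq0; apply/eqP.
  apply: (@small_eq0 _ (2 * nrm (a *: x + y) + normc a * (2 * nrm x) + 2 * nrm y)).
  move=> e e0 _; have [N /(_ N (leqnn _)) le] := invS_le e0.
  have -> : B (a *: x + y) - (a *: B x + B y) =
      (B (a *: x + y) - oppoly (p N) A (a *: x + y)) +
      (a *: (oppoly (p N) A x - B x) + (oppoly (p N) A y - B y)).
    have BD (s b t c : H) : (s - b) + (t - c) = (s + t) - (b + c).
      by rewrite opprD addrACA.
    by rewrite (oppoly_linear (p N) lA) scalerBr BD addrA subrK.
  have h1 := pB N (a *: x + y); have h2 := pB N x; have h3 := pB N y.
  rewrite nrm_distC in h1.
  have h4 := nrmD (B (a *: x + y) - oppoly (p N) A (a *: x + y))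
    (a *: (oppoly (p N) A x - B x) + (oppoly (p N) A y - B y)).
  have h5 := nrmD (a *: (oppoly (p N) A x - B x)) (oppoly (p N) A y - B y).
  have h6 : normc a * nrm (oppoly (p N) A x - B x) <= normc a * (2 * e * nrm x).
    rewrite ler_wpM2l ?normc_ge0// (le_trans h2)// ler_wpM2r ?nrm_ge0//.
    by rewrite ler_wpM2l.
  have le2 (u : H) : N.+1%:R^-1 * nrm u <= e * nrm u by rewrite ler_wpM2r ?nrm_ge0.
  rewrite nrmZ in h5; have := le2 (a *: x + y); have := le2 y.
  move: (N.+1%:R^-1) h1 h2 h3 => i; lra.
have bB : bounded_operator B.
  apply/bounded_operatorP; split=> //.
  have b0 := oppoly_bounded (p 0%N) bA.
  exists (opnorm (oppoly (p 0%N) A) + 2); first by have := opnorm_ge0 b0; lra.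
  move=> x; have := nrmB (oppoly (p 0%N) A x) (oppoly (p 0%N) A x - B x).
  rewrite opprB addrCA subrr addr0; have := pB 0%N x; have := opnorm_le x b0.
  by rewrite invr1; lra.
exists B; split=> // e e0; have [|N /(_ N (leqnn _)) le] := invS_le (_ : 0 < e / 2).
  by rewrite divr_gt0.
exists (p N); split=> [z Az|x].
  by rewrite (le_trans (pf N z Az))//; move: (N.+1%:R^-1) le => i; lra.
rewrite (le_trans (pB N x))// ler_wpM2r ?nrm_ge0//.
by move: (N.+1%:R^-1) le => i; lra.
Qed.

End FunctionalCalculus.

(** * The inequality for a factorization *)

Section NumericalRadiusBound.
Variables (R : realType) (H : completeNormedModType R[i]).
Implicit Types (x y : H) (a z u : R[i]) (A B C S T U X Y : H -> H).

Variable dot : {dot H for Num.conj}.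
Hypothesis dotE : forall x : H, dot x x = `|x| ^+ 2.

Lemma selfadjoint_scale (r : R) A : selfadjoint dot A ->
  selfadjoint dot (fun x => r%:C *: A x).
Proof.
move=> [bA AA]; split; first exact: bounded_scale.
by move=> x y; rewrite dotZl dotZr conjc_real AA.
Qed.

(** By polarization, the numerical radius of a self-adjoint operator bounds
    its norm. *)
Lemma selfadjoint_nrm_le A (w : R) x : selfadjoint dot A -> 0 <= w ->
  (forall y, `|rip dot (A y) y| <= w * nrm y ^+ 2) -> nrm (A x) <= w * nrm x.
Proof.
move=> [bA AA] w0 Aw; have [lA _] := bA.
have pol y : 2 * rip dot (A x) y <= w * (nrm x ^+ 2 + nrm y ^+ 2).
  have := Aw (x + y); have := Aw (x - y); rewrite !ler_norml => /andP[h1 _] /andP[_ h2].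
  have := parallelogram dotE x y.
  have s : rip dot (A y) x = rip dot (A x) y by rewrite /rip AA -/(rip dot _ _) ripC.
  move: h1 h2; rewrite linear_opB// linear_opD// !ripDl !ripDr !ripNl !ripNr s.
  move: (nrm (x + y) ^+ 2) (nrm (x - y) ^+ 2) => p q h1 h2 pq.
  have : w * (p + q) = w * (2 * nrm x ^+ 2 + 2 * nrm y ^+ 2) by rewrite pq.
  lra.
have [->|Ax0] := eqVneq (A x) 0; first by rewrite nrm0 mulr_ge0// nrm_ge0.
have [x0|x0] := eqVneq x 0; first by rewrite x0 linear_op0// nrm0 mulr0.
have nA : 0 < nrm (A x) by rewrite nrm_gt0.
have nx : 0 < nrm x by rewrite nrm_gt0.
(* the vector of direction [A x] and of norm [nrm x] *)
have := pol ((nrm x / nrm (A x))%:C *: A x).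
rewrite ripZr rip_nrm// nrmZ normc_real ger0_norm ?divr_ge0 ?nrm_ge0//.
have e1 : nrm x / nrm (A x) * nrm (A x) = nrm x by rewrite divfK// gt_eqF.
rewrite e1 [X in _ * (_ * X)]expr2 [_ / _ * _]mulrA e1 => h.
rewrite -(ler_pM2l nx); nra.
Qed.

Lemma nrm_adjoint_sqr_le A B (m : R) x : adjoint_pair dot B A -> 0 <= m ->
  (forall y, nrm (B y) ^+ 2 <= m * nrm y ^+ 2) -> nrm (A x) ^+ 2 <= m * nrm x ^+ 2.
Proof.
move=> BA m0 Bm.
have Bs y : nrm (B y) <= Num.sqrt m * nrm y.
  rewrite -(@ler_pXn2r _ 2)// ?nnegrE ?mulr_ge0 ?sqrtr_ge0 ?nrm_ge0//.
  by rewrite exprMn sqr_sqrtr.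
rewrite -(sqr_sqrtr m0) -exprMn lerXn2r ?nnegrE ?mulr_ge0 ?sqrtr_ge0 ?nrm_ge0//.
exact: (nrm_adjoint_le dotE BA (sqrtr_ge0 m)).
Qed.

Section Factorization.
Variables (X Y U : H -> H) (n : R).
Hypotheses (sX : selfadjoint dot X) (sY : selfadjoint dot Y).
Hypotheses (bU : bounded_operator U) (U1 : forall x, nrm (U x) <= nrm x).

Let Tt x := X (U (Y x)).
Let S x := Y (Y x) + X (X x).
Let w := numrad dot Tt.
Let v := numrad dot (fun x => S (Tt x) + Tt (S x)).

Hypothesis H_neq0 : exists x : H, x != 0.
Hypothesis Sn : forall x, nrm (S x) <= 2 * n * nrm x.
Hypothesis n0 : 0 <= n.

Let bX : bounded_operator X. Proof. by case: sX. Qed.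
Let bY : bounded_operator Y. Proof. by case: sY. Qed.
Let bTt : bounded_operator Tt.
Proof. exact: bounded_comp bX (bounded_comp bU bY). Qed.
Let bS : bounded_operator S.
Proof. exact: bounded_add (bounded_comp bY bY) (bounded_comp bX bX). Qed.
Let bST : bounded_operator (fun x => S (Tt x) + Tt (S x)).
Proof. exact: bounded_add (bounded_comp bS bTt) (bounded_comp bTt bS). Qed.

Let w0 : 0 <= w. Proof. exact: numrad_ge0. Qed.
Let v0 : 0 <= v. Proof. exact: numrad_ge0. Qed.

Let q := Num.sqrt (n ^+ 2 + w ^+ 2 + 2^-1 * v).
Let q2 : q ^+ 2 = n ^+ 2 + w ^+ 2 + 2^-1 * v.
Proof. by rewrite sqr_sqrtr// !addr_ge0 ?sqr_ge0// mulr_ge0// invr_ge0. Qed.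

Lemma weight_adjoint : adjoint_pair dot S S.
Proof.
have [_ XX] := sX; have [_ YY] := sY.
by move=> x y; rewrite /S dotDl dotDr YY YY XX XX.
Qed.

(** [2 Re (u Tt)] *)
Let G u x := u *: Tt x + conjc u *: adjoint dot Tt x.

Let TtP : adjoint_pair dot Tt (adjoint dot Tt).
Proof. by case: (adjointP dotE bTt). Qed.

Lemma tilt_selfadjoint u : selfadjoint dot (G u).
Proof.
split.
  by apply: bounded_add; apply: bounded_scale => //; case: (adjointP dotE bTt).
move=> x y; rewrite /G dotDl dotDr !dotZl !dotZr conjcK TtP.
by rewrite (adjoint_pairC TtP) addrC.
Qed.

Lemma rip_tilt u x : rip dot (G u x) x = 2 * Re (u * dot (Tt x) x).
Proof.
rewrite /rip /G dotDl !dotZl (adjoint_pairC TtP) (dotC dot x).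
by move: (dot (Tt x) x) => a; case: u a => b c [d e] /=; ring.
Qed.

Lemma nrm_tilt_le u x : normc u = 1 -> nrm (G u x) <= 2 * w * nrm x.
Proof.
move=> u1; apply: (selfadjoint_nrm_le _ (tilt_selfadjoint u)); first by rewrite mulr_ge0.
move=> y; rewrite rip_tilt normrM ger0_norm// -mulrA ler_wpM2l//.
apply: le_trans (numrad_le dotE y bTt).
by rewrite -[leRHS]mul1r -u1 -normcM -lecR -norm_normc normc_ge_Re.
Qed.

Lemma rip_weight_tilt u x : rip dot (S x) (G u x) =
  Re (u * dot (S (Tt x) + Tt (S x)) x).
Proof.
rewrite /rip /G dotDr !dotZr conjcK -TtP dotDl weight_adjoint (dotC dot x).
by move: (dot (S _) x) (dot (Tt (S _)) x) => a b; case: u a b => ? ? [? ?] [? ?] /=; ring.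
Qed.

(** The three terms of the square on the left are bounded by those in [4 q^2]. *)
Lemma nrm_weight_tilt_le u x : normc u = 1 -> nrm (S x + G u x) <= 2 * q * nrm x.
Proof.
move=> u1; rewrite -(@ler_pXn2r _ 2)// ?nnegrE ?mulr_ge0 ?sqrtr_ge0 ?nrm_ge0//.
rewrite (nrmD_sqr dotE) !exprMn q2 rip_weight_tilt.
have h1 : nrm (S x) ^+ 2 <= (2 * n * nrm x) ^+ 2.
  by rewrite lerXn2r ?nnegrE ?mulr_ge0 ?nrm_ge0.
have h2 : nrm (G u x) ^+ 2 <= (2 * w * nrm x) ^+ 2.
  by rewrite lerXn2r ?nnegrE ?mulr_ge0 ?nrm_ge0// nrm_tilt_le.
have h3 : Re (u * dot (S (Tt x) + Tt (S x)) x) <= v * nrm x ^+ 2.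
  apply: le_trans (numrad_le dotE x bST).
  by rewrite (le_trans (Re_le_normc _))// normcM u1 mul1r.
move: h1 h2; rewrite !exprMn; lra.
Qed.

(** For [B = conj u X + U Y], [B^* B <= S + 2 Re (u Tt)]; the only loss is in
    [|U Y y| <= |Y y|]. *)
Lemma nrm_cofactor_le u y : normc u = 1 ->
  nrm (conjc u *: X y + U (Y y)) ^+ 2 <= 2 * q * nrm y ^+ 2.
Proof.
move=> u1; have [_ XX] := sX; have [_ YY] := sY.
have u1' : normc (conjc u) = 1 by rewrite -u1; case: (u) => b c /=; rewrite sqrrN.
have cross : rip dot (conjc u *: X y) (U (Y y)) = Re (u * dot (Tt y) y).
  rewrite /rip /Tt XX dotZl (dotC dot (X y)).
  by move: (dot (U _) _) => a; case: u a {u1 u1'} => ? ? [? ?] /=; ring.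
have WE : rip dot (S y + G u y) y =
    nrm (X y) ^+ 2 + nrm (Y y) ^+ 2 + 2 * Re (u * dot (Tt y) y).
  have eX : rip dot (X (X y)) y = nrm (X y) ^+ 2 by rewrite -(rip_nrm dotE) /rip XX.
  have eY : rip dot (Y (Y y)) y = nrm (Y y) ^+ 2 by rewrite -(rip_nrm dotE) /rip YY.
  by rewrite ripDl rip_tilt /S ripDl eX eY; ring.
apply: (@le_trans _ _ (rip dot (S y + G u y) y)).
  rewrite (nrmD_sqr dotE) cross WE nrmZ u1' mul1r lerD2r lerD2l.
  by rewrite lerXn2r ?nnegrE ?nrm_ge0.
rewrite (le_trans (rip_le dotE _ _))// expr2 mulrA.
by rewrite ler_wpM2r ?nrm_ge0// nrm_weight_tilt_le.
Qed.

(** [Re (u <U Y X x, x>)] is half of the cross term in [|u X x + Y U^* x|^2], hence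
    at most a quarter of that square; and [u X + Y U^*] is the adjoint of the
    operator in [nrm_cofactor_le]. *)
Lemma numrad_factorization :
  numrad dot (fun x => U (Y (X x))) <=
  2^-1 * Num.sqrt (n ^+ 2 + w ^+ 2 + 2^-1 * v).
Proof.
have [_ XX] := sX; have [_ YY] := sY.
have [_ UU'] := adjointP dotE bU; set U' := adjoint dot U in UU'.
apply: numrad_ub => // x x1; rewrite -/q.
have [u u1 uE] := rotation (dot (U (Y (X x))) x).
pose A y := u *: X y + Y (U' y).
have BA : adjoint_pair dot (fun y => conjc u *: X y + U (Y y)) A.
  by move=> y z; rewrite /A dotDl dotDr dotZl dotZr XX UU' YY.
have Ax : nrm (A x) ^+ 2 <= 2 * q * nrm x ^+ 2.
  apply: (nrm_adjoint_sqr_le x BA); first by rewrite mulr_ge0// sqrtr_ge0.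
  by move=> y; exact: nrm_cofactor_le.
have -> : normc (dot (U (Y (X x))) x) = rip dot (u *: X x) (Y (U' x)).
  by have [lY _] := bY; rewrite /rip -YY (linear_opZ lY) dotZl -UU' uE.
move: Ax; rewrite x1 expr1n mulr1 (nrmD_sqr dotE).
have := sqr_ge0 (nrm (u *: X x - Y (U' x))); rewrite (nrmB_sqr dotE); lra.
Qed.

End Factorization.
End NumericalRadiusBound.

(** * Powers of positive operators and polar decomposition *)

Section Powers.
Variables (R : realType) (H : completeNormedModType R[i]).
Implicit Types (x y : H) (z : R[i]) (A B T U P : H -> H).

Variable dot : {dot H for Num.conj}.
Hypothesis dotE : forall x : H, dot x x = `|x| ^+ 2.
Hypothesis H_neq0 : exists x : H, x != 0.

Definition positive_op A := selfadjoint dot A /\ forall x, 0 <= rip dot (A x) x.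

Lemma spectrum_positive A z : positive_op A -> spectrum A z ->
  z = (Re z)%:C /\ 0 <= Re z <= opnorm A.
Proof.
move=> [sA A0] Az; have z0 := spectrum_real dotE sA Az.
split; first by case: (z) z0 => b c /= ->.
rewrite (spectrum_ge0 dotE sA A0 Az)/=.
by rewrite (le_trans (Re_le_normc _))// (spectrum_bounded dotE sA).
Qed.

Definition powc (s : R) z : R[i] := (Re z `^ s)%:C.

Lemma oppowP A (s : R) : positive_op A -> 0 <= s -> cfc_rel (powc s) A (oppow A s).
Proof.
move=> pA s0; have [sA _] := pA; have [bA _] := sA.
have [|B] := cfc_rel_exists dotE H_neq0 (f := powc s) sA; last exact: cfc_rel_cfc.
move=> e e0; have [|p pe] := @weierstrass R (fun r : R => `|r| `^ s)
  (opnorm A + 1) e _ e0 (continuous_powR_abs s0).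
  by rewrite ltr_wpDl// opnorm_ge0.
exists (map_poly (real_complex R) p) => z Az.
have [zE /andP[z0 zA]] := spectrum_positive pA Az.
rewrite [in X in normc (X - _)]zE horner_map /powc -rmorphB normc_real.
by rewrite -{2}(ger0_norm z0) pe// z0/= (le_trans zA)// lerDl ler01.
Qed.

Lemma oppow_selfadjoint A (s : R) : positive_op A -> 0 <= s -> selfadjoint dot (oppow A s).
Proof.
move=> pA s0; have [sA _] := pA.
by apply: (cfc_rel_selfadjoint dotE H_neq0 sA _ (oppowP pA s0)) => z _; exact: conjc_real.
Qed.

Lemma le_powR_exponent_ge0 (s a b : R) : 0 <= s -> 0 <= a <= b -> a `^ s <= b `^ s.
Proof.
by move=> s0 /andP[a0 ab]; rewrite ge0_ler_powR// nnegrE// (le_trans a0).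
Qed.

Lemma powc_normc_le A (s : R) z : positive_op A -> 0 <= s -> spectrum A z ->
  normc (powc s z) <= opnorm A `^ s.
Proof.
move=> pA s0 Az; rewrite normc_real ger0_norm ?powR_ge0//.
by apply: le_powR_exponent_ge0 => //; case: (spectrum_positive pA Az).
Qed.

Lemma oppow_nrm_le A (s : R) x : positive_op A -> 0 <= s ->
  nrm (oppow A s x) <= opnorm A `^ s * nrm x.
Proof.
move=> pA s0; have [sA _] := pA.
apply: (cfc_rel_norm dotE H_neq0 sA _ (oppowP pA s0)) => z.
exact: powc_normc_le.
Qed.

(** For nonnegative exponents the convention [0 `^ 0 = 1] makes the exponential law
    hold at [a = 0] too. *)
Lemma powRD_ge0 (a s t : R) : 0 <= s -> 0 <= t -> a `^ s * a `^ t = a `^ (s + t).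
Proof.
move=> s0 t0; have [st|st] := eqVneq (s + t) 0; last by rewrite powRD// (negbTE st).
have -> : s = 0 by lra.
have -> : t = 0 by lra.
by rewrite addr0 powRr0 mulr1.
Qed.

Lemma oppowD A (s t : R) x : positive_op A -> 0 <= s -> 0 <= t ->
  oppow A s (oppow A t x) = oppow A (s + t) x.
Proof.
move=> pA s0 t0; have [sA _] := pA.
apply: (cfc_rel_mul dotE H_neq0 (F := opnorm A `^ s) (G := opnorm A `^ t) sA _ _
    (oppowP pA s0) (oppowP pA t0) (oppowP pA (addr_ge0 s0 t0))) => z Az.
  by split; exact: powc_normc_le.
by rewrite /powc -powRD_ge0// rmorphM.
Qed.

Lemma oppow1 A : positive_op A -> oppow A 1 = A.
Proof.
move=> pA; have [sA _] := pA; have [bA _] := sA.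
apply: (cfc_rel_unique dotE H_neq0 sA (fun z _ => erefl _) (oppowP pA ler01)).
apply: cfc_rel_id => // z Az; have [zE /andP[z0 _]] := spectrum_positive pA Az.
by rewrite /powc powRr1// -zE.
Qed.

Lemma rip_oppow A (s : R) x : positive_op A -> 0 <= s ->
  rip dot (oppow A (s + s) x) x = nrm (oppow A s x) ^+ 2.
Proof.
move=> pA s0; have [_ ss] := oppow_selfadjoint pA s0.
by rewrite -(oppowD x pA s0 s0) -(rip_nrm dotE) /rip ss.
Qed.

Lemma oppow_positive A (s : R) : positive_op A -> 0 <= s -> positive_op (oppow A s).
Proof.
move=> pA s0; split=> [|x]; first exact: oppow_selfadjoint.
by rewrite (splitr s) rip_oppow ?sqr_ge0// divr_ge0.
Qed.

Lemma gram_positive T : bounded_operator T -> positive_op (adjoint dot T \o T).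
Proof.
move=> bT; have [bT' TT'] := adjointP dotE bT; split=> [|x]; first split.
- exact: bounded_comp.
- by move=> x y /=; rewrite -TT' (adjoint_pairC TT').
- by rewrite /rip/= (adjoint_pairC TT') -/(rip dot _ _) (rip_nrm dotE) sqr_ge0.
Qed.

Lemma absop_positive T : bounded_operator T -> positive_op (absop dot T).
Proof. by move=> bT; apply: oppow_positive; [exact: gram_positive|rewrite invr_ge0]. Qed.

Lemma absop_nrm T x : bounded_operator T -> nrm (absop dot T x) = nrm (T x).
Proof.
move=> bT; have pG := gram_positive bT; have [_ TT'] := adjointP dotE bT.
apply/eqP; rewrite -(@eqrXn2 _ 2) ?nrm_ge0// -rip_oppow ?invr_ge0//.
have -> : 2^-1 + 2^-1 = 1 :> R by lra.
by rewrite oppow1// -(rip_nrm dotE) /rip/= (adjoint_pairC TT').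
Qed.

Lemma absop_opnorm T : bounded_operator T -> opnorm (absop dot T) = opnorm T.
Proof.
move=> bT; have [[bP _] _] := absop_positive bT.
apply/eqP; rewrite eq_le; apply/andP; split; apply: opnorm_ub => [|x].
- exact: opnorm_ge0.
- by rewrite absop_nrm// opnorm_le.
- exact: opnorm_ge0.
- by rewrite -absop_nrm// opnorm_le.
Qed.

(** A partial isometry is the isometry of its definition after the orthogonal
    projection onto the complement of its kernel. *)
Lemma partial_isometry_nrm_le U x : partial_isometry dot U -> nrm (U x) <= nrm x.
Proof.
move=> [bU isoU]; have [lU _] := bU.
have [|||k Uk orth] := projection dotE (K := kernel U) x.
- exact: linear_op0.
- by move=> a y z /= Uy Uz; rewrite /kernel/= lU Uy Uz scaler0 addr0.
- move=> u l Uu ul; rewrite /kernel/=; apply/(@small_eq0 _ _ _ (opnorm U)) => e e0 _.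
  have [N /(_ N (leqnn _)) le] := ul _ e0.
  have -> : U l = U (l - u N) by rewrite linear_opB// Uu subr0.
  rewrite (le_trans (opnorm_le _ bU))// mulrC ler_wpM2r ?opnorm_ge0//.
  by rewrite nrm_distC.
have -> : U x = U (x - k) by rewrite linear_opB// Uk subr0.
have -> : nrm (U (x - k)) = nrm (x - k) by rewrite /nrm isoU.
rewrite -(@ler_pXn2r _ 2)// ?nnegrE ?nrm_ge0//.
have -> : nrm x ^+ 2 = nrm (x - k) ^+ 2 + nrm k ^+ 2.
  by have := nrmD_sqr dotE (x - k) k; rewrite subrK /rip (orth k Uk)/= mulr0 addr0.
by rewrite lerDl sqr_ge0.
Qed.

End Powers.

Theorem theorem2p4 (R : realType)
  (H : completeNormedModType R[i]) (dot : {dot H for Num.conj})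
  (dotE : forall x : H, dot x x = `|x| ^+ 2)
  (T U : H -> H) (hT : bounded_operator T) (T_neq0 : exists x, T x != 0)
  (hU : polar_decomposition dot T U)
  (t : R) (ht : 0 <= t <= 1) :
  let St := aluthge_weight dot T t in
  let Tt := aluthge dot T U t in
  numrad dot T <=
    2^-1 * Num.sqrt (opnorm T ^+ 2 + numrad dot Tt ^+ 2
                     + 2^-1 * numrad dot (fun x => St (Tt x) + Tt (St x))).
Proof.
cbv zeta; set St := aluthge_weight _ _ _; set Tt := aluthge _ _ _ _.
have [pU _ TE] := hU; have [bU _] := pU; have [lU _] := bU.
have [t0 t1] : 0 <= t /\ 0 <= 1 - t by lra.
have H_neq0 : exists x : H, x != 0.
  have [x Tx] := T_neq0; exists x; apply: contra Tx => /eqP ->.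
  by rewrite linear_op0//; case: hT.
set n := opnorm T; set P := absop dot T.
have pP : positive_op dot P := absop_positive dotE H_neq0 hT.
have Pn : opnorm P = n := absop_opnorm dotE H_neq0 hT.
have n0 : 0 < n.
  have [x Tx] := T_neq0; rewrite lt_def opnorm_ge0// andbT; apply/negP => /eqP n0.
  have := opnorm_le x hT; rewrite -/n n0 mul0r leNgt => /negP; apply.
  by rewrite nrm_gt0.
pose c := n `^ ((1 - 2 * t) / 2); pose c' := n `^ ((2 * t - 1) / 2).
have nD a b : n `^ a * n `^ b = n `^ (a + b) by rewrite powRD// (gt_eqF n0) implybT.
have cc' : c * c' = 1 by rewrite nD -mulrDl (_ : _ + _ = 0) ?mul0r ?powRr0//; ring.
have c2 : c * c = n `^ (1 - 2 * t) by rewrite nD -splitr.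
have c'2 : c' * c' = n `^ (2 * t - 1) by rewrite nD -splitr.
pose X x := c%:C *: oppow P t x; pose Y x := c'%:C *: oppow P (1 - t) x.
have sPt := oppow_selfadjoint dotE H_neq0 pP t0.
have sPt' := oppow_selfadjoint dotE H_neq0 pP t1.
have sX : selfadjoint dot X by exact: selfadjoint_scale.
have sY : selfadjoint dot Y by exact: selfadjoint_scale.
have [[lPt _] _] := sPt; have [[lPt' _] _] := sPt'.
have XXE x : X (X x) = (n `^ (1 - 2 * t))%:C *: oppow P (2 * t) x.
  rewrite /X (linear_opZ lPt) scalerA -rmorphM/= c2 (oppowD dotE H_neq0 _ pP t0 t0).
  by rewrite (_ : t + t = 2 * t)//; ring.
have YYE x : Y (Y x) = (n `^ (2 * t - 1))%:C *: oppow P (2 * (1 - t)) x.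
  rewrite /Y (linear_opZ lPt') scalerA -rmorphM/= c'2 (oppowD dotE H_neq0 _ pP t1 t1).
  by rewrite (_ : (1 - t) + (1 - t) = 2 * (1 - t))//; ring.
have SE : St = fun x => Y (Y x) + X (X x).
  by apply/funext => x; rewrite XXE YYE.
have TtE : Tt = fun x => X (U (Y x)).
  apply/funext => x; rewrite /X /Y (linear_opZ lU) (linear_opZ lPt) scalerA.
  by rewrite -rmorphM/= cc' scale1r.
have TE' : T = fun x => U (Y (X x)).
  apply/funext => x; rewrite /X /Y (linear_opZ lPt') scalerA -rmorphM/= mulrC cc'.
  rewrite scale1r (oppowD dotE H_neq0)// subrK (oppow1 dotE H_neq0)//.
  by rewrite {1}TE.
have Sn x : nrm (Y (Y x) + X (X x)) <= 2 * n * nrm x.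
  have nr s : 0 <= s -> n `^ (1 - s) * nrm (oppow P s x) <= n * nrm x.
    move=> s0; have -> : n * nrm x = n `^ (1 - s) * (n `^ s * nrm x).
      by rewrite mulrA nD subrK (powRr1 (ltW n0)).
    by rewrite ler_wpM2l ?powR_ge0// -Pn (oppow_nrm_le dotE H_neq0).
  rewrite (le_trans (nrmD _ _))// XXE YYE !nrmZ !normc_real !ger0_norm ?powR_ge0//.
  have -> : 2 * t - 1 = 1 - 2 * (1 - t) by ring.
  have h1 : 0 <= 2 * t by lra.
  have h2 : 0 <= 2 * (1 - t) by lra.
  apply: le_trans (lerD (nr _ h2) (nr _ h1)) _.
  by rewrite -mulrA mulr_natl mulr2n.
rewrite SE TtE {1}TE'.
apply: numrad_factorization => //; last exact: ltW.
by move=> x; exact: partial_isometry_nrm_le.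
Qed.
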